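(* Let $\mathfrak{M}$ be an equicontinuous matchbox manifold. Then its asymptotic discriminant $\mathcal{I}(\mathfrak{M})=[\mathcal{I}(\mathcal{U},x)]_\infty$ is well-defined, that is, the tail equivalence class is independent of the choice of the regular foliated covering, of the point $x$ in the resulting transversal space $\mathfrak{X}$, and of the adapted neighborhood basis $\mathcal{U}$ at $x$. Moreover it is an invariant of the homeomorphism class of $\mathfrak{M}$: if $\mathfrak{M}'$ is an equicontinuous matchbox manifold homeomorphic to $\mathfrak{M}$, then $\mathcal{I}(\mathfrak{M})=\mathcal{I}(\mathfrak{M}')$.
   Context: Foliated spaces. A foliated space of dimension $n$ is a compact connected metrizable space $\mathfrak{M}$ such that there is a compact separable metric space $\mathfrak{X}$ and, for each $x\in\mathfrak{M}$, a compact set $\mathfrak{T}_x\subset\mathfrak{X}$, an open set $U_x\subset\mathfrak{M}$ and a homeomorphism $\varphi_x:\overline{U}_x\to[-1,1]^n\times\mathfrak{T}_x$ with $\varphi_x(x)=(0,w_x)$, $w_x\in \mathrm{int}(\mathfrak{T}_x)$, which extends to a foliated homeomorphism onto $(-2,2)^n\times\mathfrak{T}_x$ of an open neighborhood of $\overline{U}_x$. The sets $\varphi_x^{-1}([-1,1]^n\times\{w\})$ are plaques; the connected components in the topology generated by open subsets of plaques are the leaves. A matchbox manifold is a foliated space all of whose $\mathfrak{T}_x$ are totally disconnected. All matchbox manifolds are assumed smooth (charts may be chosen with leafwise transition maps smooth and depending continuously on the transverse parameter in the $C^\infty$ topology). Holonomy pseudogroup. Choose a regular foliated covering: a finite open cover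 $U_1,\dots,U_\nu$ by such charts $\varphi_i:U_i\to(-1,1)^n\times\mathfrak{T}_i$, with plaques convex for a leafwise Riemannian metric, and with $\mathfrak{X}=\mathfrak{T}_1\sqcup\cdots\sqcup\mathfrak{T}_\nu$ a disjoint clopen decomposition (taken to be a Cantor space). Let $\pi_i:U_i\to\mathfrak{T}_i$ be the projection. If $U_i\cap U_j\neq\emptyset$, put $\mathfrak{D}_{i,j}=\pi_i(U_i\cap U_j)$ and let $h_{j,i}:\mathfrak{D}_{i,j}\to\mathfrak{D}_{j,i}$ be the homeomorphism determined by intersecting plaques. These generate the holonomy pseudogroup action $\Phi$ on $\mathfrak{X}$; $\mathcal{G}^*$ is the set of all restrictions to open sets of compositions of the $h_{j,i}$ with non-empty (maximal) domain. For $g\in\mathcal{G}^*$, $\mathfrak{D}(g)$, $\mathfrak{R}(g)$ are its domain and range. $\mathfrak{M}$ is equicontinuous if for all $\epsilon>0$ there is $\delta>0$ such that for all $g\in\mathcal{G}^*$ and $w,w'\in\mathfrak{D}(g)$, $d(w,w')<\delta$ implies $d(g(w),g(w'))<\epsilon$. (The action is then minimal.) For $W\subset\mathfrak{X}$ open, $\mathcal{G}^*_W=\{g\in\mathcal{G}^*:\mathfrak{D}(g)\subset W,\ \mathfrak{R}(g)\subset W\}$. Adapted sets. A non-empty clopen set $U\subset\mathfrak{X}$ is adapted to $\Phi$, with group $\mathcal{H}_U\subset \mathrm{Homeo}(U)$, if $\mathcal{G}^*_U$ is induced by the action of $\mathcal{H}_U$ on $U$, i.e. $\mathcal{G}^*_U$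 consists of the restrictions of elements of $\mathcal{H}_U$ to open subsets of $U$; moreover for $g\in\mathcal{G}^*$ with $U\subset\mathfrak{D}(g)$ the translate $g(U)$ is either contained in $U$ or disjoint from $U$. $\overline{\mathcal{H}_U}$ is the closure in the uniform topology on $\mathrm{Homeo}(U)$. An adapted neighborhood basis at $x\in\mathfrak{X}$ is a descending chain $\mathcal{U}=\{U_\ell\}_{\ell\ge1}$ of adapted clopen sets with $\bigcap_\ell U_\ell=\{x\}$; such bases exist at every point. Asymptotic discriminant. Let $\mathcal{I}(U_1,U_\ell,x)=\{\widehat h\in\overline{\mathcal{H}_{U_\ell}}:\widehat h(x)=x\}$. For $\ell'>\ell$, elements of $\mathcal{I}(U_1,U_\ell,x)$ preserve $U_{\ell'}$, and restriction to $U_{\ell'}$ gives surjective homomorphisms $\sigma_{U_\ell,U_{\ell'}}:\mathcal{I}(U_1,U_\ell,x)\to\mathcal{I}(U_1,U_{\ell'},x)$. Set $\mathcal{I}(\mathcal{U},x)=\{\sigma_{U_\ell,U_{\ell+1}}:\ell\ge1\}$. Tail equivalence. Two sequences of surjective group homomorphisms $\mathcal{A}=\{\phi_i:A_i\to A_{i+1}\}_{i\ge1}$ and $\mathcal{B}=\{\psi_i:B_i\to B_{i+1}\}_{i\ge1}$ are tail equivalent if there are strictly increasing sequences of indices $p_i\geq i$, $q_i\ge i$, a sequence of surjective homomorphisms $\{\tau_i:C_i\to C_{i+1}\}_{i\ge1}$, and isomorphisms $\Pi^i_{\mathcal{AC}}:A_{p_i}\to C_{2i-1}$, $\Pi^i_{\mathcal{BC}}:B_{q_i}\to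 C_{2i}$ such that for all $i\ge1$: $\tau_{2i}\circ\tau_{2i-1}\circ\Pi^i_{\mathcal{AC}}=\Pi^{i+1}_{\mathcal{AC}}\circ(\phi_{p_{i+1}-1}\circ\cdots\circ\phi_{p_i})$ and $\tau_{2i+1}\circ\tau_{2i}\circ\Pi^i_{\mathcal{BC}}=\Pi^{i+1}_{\mathcal{BC}}\circ(\psi_{q_{i+1}-1}\circ\cdots\circ\psi_{q_i})$. $[\mathcal{A}]_\infty$ denotes the tail equivalence class. *)

(* Defs.v *)
From HB Require Import structures.
From mathcomp Require Import all_boot all_order all_algebra.
From mathcomp Require Import all_classical all_reals all_analysis.

Set Implicit Arguments.
Unset Strict Implicit.
Unset Printing Implicit Defensive.

Import Order.TTheory GRing.Theory Num.Theory.
Import numFieldNormedType.Exports.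

Local Open Scope classical_set_scope.
Local Open Scope ring_scope.

Definition homeomorphic (X Y : topologicalType) : Prop :=
  exists (f : X -> Y) (g : Y -> X),
    [/\ continuous f, continuous g, cancel f g & cancel g f].

Definition metrizable (R : realType) (X : topologicalType) : Prop :=
  exists Y : metricType R, homeomorphic X Y.

Definition open_cube (R : realType) (n : nat) (a : R) : set 'rV[R]_n :=
  [set v | forall i, - a < v ord0 i < a].

Definition closed_cube (R : realType) (n : nat) (a : R) : set 'rV[R]_n :=
  [set v | forall i, - a <= v ord0 i <= a].

Arguments open_cube {R} n a.
Arguments closed_cube {R} n a.

(* [ch_map] is the extended chart, defined on the open neighbourhood [ch_ext]
   of the closure of [ch_dom]; the values of [ch_map] outside [ch_ext] and of
   [ch_inv] outside (-2,2)^n x [ch_tr] are irrelevant. *)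
Record chart (R : realType) (n : nat) (M X : topologicalType) := Chart {
  ch_dom : set M ;
  ch_ext : set M ;
  ch_tr  : set X ;
  ch_map : M -> 'rV[R]_n * X ;
  ch_inv : 'rV[R]_n * X -> M
}.

Section Charts.
Context {R : realType} {n : nat} {M X : topologicalType}.
Implicit Types c : chart R n M X.

Definition ch_leaf c (y : M) : 'rV[R]_n := (ch_map c y).1.
Definition ch_proj c (y : M) : X := (ch_map c y).2.

Definition is_chart c : Prop :=
  [/\ [/\ open (ch_dom c), open (ch_ext c), compact (ch_tr c)
        & closure (ch_dom c) `<=` ch_ext c],
      [/\ forall y, ch_ext c y -> (open_cube n 2 `*` ch_tr c) (ch_map c y),
          forall p, (open_cube n 2 `*` ch_tr c) p -> ch_ext c (ch_inv c p),
          forall y, ch_ext c y -> ch_inv c (ch_map c y) = y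
        & forall p, (open_cube n 2 `*` ch_tr c) p -> ch_map c (ch_inv c p) = p],
      {within ch_ext c, continuous (ch_map c)},
      {within open_cube n 2 `*` ch_tr c, continuous (ch_inv c)}
    & ch_map c @` closure (ch_dom c) = closed_cube n 1 `*` ch_tr c].

(* On overlaps, the extended charts have locally the same plaques. *)
Definition foliated_compatible c c' : Prop :=
  forall y, ch_ext c y -> ch_ext c' y ->
  exists2 N : set M, nbhs y N &
    forall y1 y2, N y1 -> N y2 ->
      ch_proj c y1 = ch_proj c y2 <-> ch_proj c' y1 = ch_proj c' y2.

Definition plaque c (w : X) : set M :=
  [set y | closure (ch_dom c) y /\ ch_proj c y = w].

(* Leafwise C^k on D: all partial derivatives of order at most k along the
   first factor exist and are jointly continuous on D.  Joint continuity is
   the continuous dependence on the transverse parameter in the C^k topology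
   (uniform convergence of derivatives on compact sets). *)
Fixpoint leaf_Ck (V : normedModType R) (k : nat) (D : set ('rV[R]_n * X))
    (F : 'rV[R]_n * X -> V) : Prop :=
  {within D, continuous F} /\
  if k is k'.+1 then
    forall i : 'I_n,
      (forall p, D p ->
        derivable (fun v => F (v, p.2)) p.1 (delta_mx ord0 i)) /\
      leaf_Ck k' D (fun p => 'D_(delta_mx ord0 i) (fun v => F (v, p.2)) p.1)
  else True.

Definition leaf_smooth (V : normedModType R) (D : set ('rV[R]_n * X))
    (F : 'rV[R]_n * X -> V) : Prop :=
  forall k, leaf_Ck k D F.

Definition smooth_transition c c' : Prop :=
  leaf_smooth (ch_map c @` (ch_dom c `&` ch_dom c'))
    (fun p => ch_leaf c' (ch_inv c p)).

End Charts.

Definition foliated_atlas (R : realType) (n : nat) (M : topologicalType)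
    (X : metricType R) (c : M -> chart R n M X) : Prop :=
  [/\ compact [set: X],
      forall x, is_chart (c x),
      forall x, ch_dom (c x) x,
      forall x, ch_leaf (c x) x = 0 /\ interior (ch_tr (c x)) (ch_proj (c x) x)
    & forall x y, foliated_compatible (c x) (c y)].

Definition foliated_space (R : realType) (n : nat) (M : topologicalType)
    (X : metricType R) (c : M -> chart R n M X) : Prop :=
  [/\ compact [set: M], connected [set: M], metrizable R M & foliated_atlas c].

Definition matchbox_manifold (R : realType) (n : nat) (M : topologicalType)
    : Prop :=
  exists (X : metricType R) (c : M -> chart R n M X),
    [/\ foliated_space c,
        forall x, totally_disconnected (ch_tr (c x))
      & forall x y, smooth_transition (c x) (c y)].

(* A leafwise Riemannian metric is given in the chart k by the Gram matrices
   [g k], and tangent vectors are row vectors. *)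
Section LeafwiseMetric.
Context {R : realType} {n nu : nat} {M X : topologicalType}.
Variables (c : 'I_nu -> chart R n M X) (g : 'I_nu -> 'rV[R]_n * X -> 'M[R]_n).

Definition metric_form (k : 'I_nu) (y : M) (u v : 'rV[R]_n) : R :=
  (u *m g k (ch_map (c k) y) *m v^T) ord0 ord0.

Definition transition_diff (i j : 'I_nu) (y : M) (u : 'rV[R]_n) : 'rV[R]_n :=
  'D_u (fun v => ch_leaf (c j) (ch_inv (c i) (v, ch_proj (c i) y)))
    (ch_leaf (c i) y).

Definition is_leafwise_metric : Prop :=
  [/\ forall i, leaf_smooth (ch_map (c i) @` ch_dom (c i)) (g i),
      forall i y, ch_dom (c i) y ->
        (g i (ch_map (c i) y))^T = g i (ch_map (c i) y),
      forall i y u, ch_dom (c i) y -> u != 0 -> 0 < metric_form i y u u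
    & forall i j y u v, ch_dom (c i) y -> ch_dom (c j) y ->
        metric_form i y u v =
        metric_form j y (transition_diff i j y u) (transition_diff i j y v)].

Definition velocity (k : 'I_nu) (gam : R -> M) : R -> 'rV[R]_n :=
  derive1 (ch_leaf (c k) \o gam).

(* C^1 curves in leaves, parametrized by [0,1]; the curve is required to be
   C^1 on a neighbourhood of [0,1] so that two-sided derivatives make sense at
   the endpoints. *)
Definition leaf_curve (gam : R -> M) : Prop :=
  forall t : R, 0 <= t <= 1 -> exists k : 'I_nu,
    \forall s \near t,
      [/\ ch_dom (c k) (gam s),
          ch_proj (c k) (gam s) = ch_proj (c k) (gam t),
          derivable (ch_leaf (c k) \o gam) s 1
        & {for s, continuous (velocity k gam)}].

(* Charts containing [gam t] all give the same value of the speed, so the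
   maximum only selects this common value. *)
Definition leaf_speed (gam : R -> M) (t : R) : R :=
  \big[Num.max/0]_(k < nu | `[< ch_dom (c k) (gam t) >])
    Num.sqrt (metric_form k (gam t) (velocity k gam t) (velocity k gam t)).

Definition leaf_length (gam : R -> M) : \bar R :=
  (\int[lebesgue_measure]_(t in `[0%R, 1%R]) (leaf_speed gam t)%:E)%E.

Definition leaf_curve_from_to (p q : M) (gam : R -> M) : Prop :=
  [/\ leaf_curve gam, gam 0 = p & gam 1 = q].

(* Constant speed is required because uniqueness of shortest geodesics is
   meant up to reparametrization. *)
Definition shortest_geodesic (p q : M) (gam : R -> M) : Prop :=
  [/\ leaf_curve_from_to p q gam,
      forall t : R, 0 <= t <= 1 -> leaf_speed gam t = leaf_speed gam 0
    & forall gam', leaf_curve_from_to p q gam' ->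
        (leaf_length gam <= leaf_length gam')%E].

Definition leaf_convex (P : set M) : Prop :=
  forall p q, P p -> P q -> exists gam,
    [/\ shortest_geodesic p q gam,
        forall t : R, 0 <= t <= 1 -> P (gam t)
      & forall gam', shortest_geodesic p q gam' ->
          forall t : R, 0 <= t <= 1 -> gam' t = gam t].

End LeafwiseMetric.

(* The leaves of M are its path components, because the transversals are
   totally disconnected, so the charts of a covering need not be compared with
   the atlas in [matchbox_manifold].  The smooth structure and the leafwise
   metric are part of the choice of the covering.  [rc_plaque_meet] is what
   makes the holonomy maps h_{j,i} single-valued and injective. *)
Record regular_covering (R : realType) (n : nat) (M : topologicalType) :=
  RegularCovering {
  rc_X : metricType R ;
  rc_nu : nat ;
  rc_chart : 'I_rc_nu -> chart R n M rc_X ;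
  rc_metric : 'I_rc_nu -> 'rV[R]_n * rc_X -> 'M[R]_n ;
  rc_is_chart : forall i, is_chart (rc_chart i) ;
  rc_foliated : forall i j, foliated_compatible (rc_chart i) (rc_chart j) ;
  rc_smooth : forall i j, smooth_transition (rc_chart i) (rc_chart j) ;
  rc_dom : forall i, ch_map (rc_chart i) @` ch_dom (rc_chart i) =
             open_cube n 1 `*` ch_tr (rc_chart i) ;
  rc_cover : forall y, exists i, ch_dom (rc_chart i) y ;
  rc_cantor : cantor_like rc_X ;
  rc_tr_clopen : forall i, clopen (ch_tr (rc_chart i)) ;
  rc_tr_neq0 : forall i, ch_tr (rc_chart i) !=set0 ;
  rc_tr_disjoint : forall i j,
    ch_tr (rc_chart i) `&` ch_tr (rc_chart j) !=set0 -> i = j ;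
  rc_tr_cover : forall w, exists i, ch_tr (rc_chart i) w ;
  rc_is_metric : is_leafwise_metric rc_chart rc_metric ;
  rc_convex : forall i w, ch_tr (rc_chart i) w ->
    leaf_convex rc_chart rc_metric (plaque (rc_chart i) w) ;
  rc_plaque_meet : forall i j w w1 w2,
    plaque (rc_chart i) w `&` plaque (rc_chart j) w1 !=set0 ->
    plaque (rc_chart i) w `&` plaque (rc_chart j) w2 !=set0 -> w1 = w2
}.

Section HolonomyPseudogroup.
Context {R : realType} {n : nat} {M : topologicalType}.
Variable C : regular_covering R n M.
Let X := rc_X C.

(* The graph of h_{j,i}. *)
Definition hol_gen (i j : 'I_(rc_nu C)) (w w' : X) : Prop :=
  exists y, [/\ ch_dom (rc_chart i) y, ch_dom (rc_chart j) y,
                ch_proj (rc_chart i) y = w & ch_proj (rc_chart j) y = w'].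

(* Graphs of compositions of generators, on their maximal domains. *)
Inductive hol_comp : (X -> X -> Prop) -> Prop :=
| hol_comp_gen i j : hol_comp (hol_gen i j)
| hol_comp_comp r s : hol_comp r -> hol_comp s ->
    hol_comp (fun w w' => exists w0, r w w0 /\ s w0 w').

(* [Gstar V g] says that the restriction of g to V belongs to G^*.  An element
   of G^* is encoded by its domain V and any total function g extending it. *)
Definition Gstar (V : set X) (g : X -> X) : Prop :=
  open V /\ exists r, [/\ hol_comp r, exists w w', r w w'
                        & forall w, V w -> r w (g w)].

Definition equicontinuous_covering : Prop :=
  forall eps : R, 0 < eps -> exists2 delta : R, 0 < delta &
    forall V g, Gstar V g -> forall w w', V w -> V w' ->
      mdist w w' < delta -> mdist (g w) (g w') < eps.

Definition Gstar_in (W V : set X) (g : X -> X) : Prop :=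
  [/\ Gstar V g, V `<=` W & g @` V `<=` W].

End HolonomyPseudogroup.

Definition equicontinuous_matchbox_manifold (R : realType) (n : nat)
    (M : topologicalType) : Prop :=
  matchbox_manifold R n M /\
  exists C : regular_covering R n M, equicontinuous_covering C.

(* Homeo(U): self-homeomorphisms of the subspace U, as functions on the
   ambient type; they are set to be the identity outside U, so that Leibniz
   equality is equality of maps on U. *)
Record homeo (X : topologicalType) (U : set X) := Homeo {
  hm_fun :> X -> X ;
  hm_inv : X -> X ;
  hm_fun_in : forall w, U w -> U (hm_fun w) ;
  hm_inv_in : forall w, U w -> U (hm_inv w) ;
  hm_funK : forall w, U w -> hm_inv (hm_fun w) = w ;
  hm_invK : forall w, U w -> hm_fun (hm_inv w) = w ;
  hm_fun_cont : {within U, continuous hm_fun} ;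
  hm_inv_cont : {within U, continuous hm_inv} ;
  hm_fun_out : forall w, ~ U w -> hm_fun w = w ;
  hm_inv_out : forall w, ~ U w -> hm_inv w = w
}.

Section HomeoGroup.
Context {X : topologicalType} {U : set X}.
Implicit Types f g h : homeo U.

Lemma homeo_eq f g : (forall w, U w -> f w = g w) -> f = g.
Proof.
move=> fg.
have Efun : hm_fun f = hm_fun g.
  apply: funext => w; have [Uw|Uw] := pselect (U w); first exact: fg.
  by rewrite !hm_fun_out.
have Einv : hm_inv f = hm_inv g.
  apply: funext => w; have [Uw|Uw] := pselect (U w); last by rewrite !hm_inv_out.
  rewrite -[w in LHS](hm_invK g Uw) -Efun hm_funK //; exact: hm_inv_in.
case: f g Efun Einv {fg} => f1 f2 ? ? ? ? ? ? ? ? [g1 g2 ? ? ? ? ? ? ? ?] /= E1 E2.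
by subst g1 g2; congr Homeo; exact: Prop_irrelevance.
Qed.

Lemma within_cont_comp (f g : X -> X) : (forall w, U w -> U (f w)) ->
  {within U, continuous f} -> {within U, continuous g} ->
  {within U, continuous (g \o f)}.
Proof.
move=> fU /subspace_continuousP cf /subspace_continuousP cg.
apply/subspace_continuousP => x Ux.
apply: (@cvg_comp _ _ _ f g _ (within U (nbhs (f x)))); last first.
  by apply: cg; exact: fU.
move=> A wA; have /= H := cf x Ux _ wA.
change (nbhs x [set y | U y -> A (f y)]).
have {}H : nbhs x [set y | U y -> U (f y) -> A (f y)] by exact: H.
by apply: filterS H => y H Uy; apply: H => //; exact: fU.
Qed.

Definition homeo_one : homeo U.
Proof.
by apply: (@Homeo X U id id) => //; apply: continuous_subspaceT => ? ?.
Defined.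

Definition homeo_mul f g : homeo U.
Proof.
apply: (@Homeo X U (f \o g) (hm_inv g \o hm_inv f)) => /=.
- by move=> w Uw; do 2 apply: hm_fun_in.
- by move=> w Uw; do 2 apply: hm_inv_in.
- by move=> w Uw; rewrite !hm_funK //; exact: hm_fun_in.
- by move=> w Uw; rewrite !hm_invK //; exact: hm_inv_in.
- apply: within_cont_comp; [exact: hm_fun_in|exact: hm_fun_cont..].
- apply: within_cont_comp; [exact: hm_inv_in|exact: hm_inv_cont..].
- by move=> w Uw; rewrite !hm_fun_out // hm_fun_out.
- by move=> w Uw; rewrite !hm_inv_out // hm_inv_out.
Defined.

Definition homeo_inv f : homeo U.
Proof.
apply: (@Homeo X U (hm_inv f) f).
- exact: hm_inv_in.
- exact: hm_fun_in.
- exact: hm_invK.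
- exact: hm_funK.
- exact: hm_inv_cont.
- exact: hm_fun_cont.
- exact: hm_inv_out.
- exact: hm_fun_out.
Defined.

HB.instance Definition _ := gen_eqMixin (homeo U).
HB.instance Definition _ := gen_choiceMixin (homeo U).

Lemma homeo_mulA : associative homeo_mul.
Proof. by move=> f g h; apply: homeo_eq. Qed.
Lemma homeo_mul1 : left_id homeo_one homeo_mul.
Proof. by move=> f; apply: homeo_eq. Qed.
Lemma homeo_1mul : right_id homeo_one homeo_mul.
Proof. by move=> f; apply: homeo_eq. Qed.
Lemma homeo_mulV : left_inverse homeo_one homeo_inv homeo_mul.
Proof. by move=> f; apply: homeo_eq => w Uw /=; rewrite hm_funK. Qed.
Lemma homeo_Vmul : right_inverse homeo_one homeo_inv homeo_mul.
Proof. by move=> f; apply: homeo_eq => w Uw /=; rewrite hm_invK. Qed.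

HB.instance Definition _ := isGroup.Build (homeo U)
  homeo_mulA homeo_mul1 homeo_1mul homeo_mulV homeo_Vmul.

End HomeoGroup.

Section CompactMetric.
Context {R : realType} {X : metricType R}.

Lemma ballE (x y : X) (e : R) : ball x e y = (mdist x y < e) :> Prop.
Proof. by rewrite ballEmdist. Qed.

Lemma compact_unif_cont (U : set X) (f : X -> X) :
  compact U -> {within U, continuous f} ->
  forall e : R, 0 < e -> exists2 d : R, 0 < d & forall x y, U x -> U y ->
    mdist x y < d -> mdist (f x) (f y) < e.
Proof.
move=> /compact_near_coveringP cU /subspace_continuousP cf e e0.
have H : \forall d \near (0 : R)^'+, forall x, U x -> U x -> forall y, U y ->
    mdist x y < d -> mdist (f x) (f y) < e.
  apply: (cU R (0 : R)^'+ (fun d x => U x -> forall y, U y -> mdist x y < d ->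
    mdist (f x) (f y) < e)) => x Ux.
  have e2 : 0 < e / 2 by rewrite divr_gt0.
  have H0 : nbhs x [set y | U y -> ball (f x) (e / 2) (f y)].
    exact: (cf x Ux _ (nbhsx_ballx (f x) _ e2)).
  have [r /= r0 Hr] := (nbhs_ballP _ _).1 H0.
  have r2 : 0 < r / 2 by rewrite divr_gt0.
  exists (ball x (r / 2), [set d : R | d < r / 2]).
    by split; [exact: nbhsx_ballx | exact: nbhs_right_lt].
  move=> [z d] /= [xz dr] Uz y Uy zy.
  have xz' : ball x r z.
    by apply: le_ball xz; rewrite ler_pdivrMr // ler_pMr // ler1n.
  have xy : ball x r y.
    rewrite (splitr r); apply: ball_triangle xz _.
    by rewrite ballE (lt_trans zy).
  rewrite -ballE (splitr e); apply: (ball_triangle _ (Hr y xy Uy)).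
  by apply: ball_sym; exact: Hr.
have [d [d0 Hd]] := filter_ex (filterI (nbhs_right_gt (0 : R)) H).
by exists d => // x y Ux Uy xy; exact: (Hd x Ux Ux y Uy xy).
Qed.

Lemma compact_open_ball (K O : set X) : compact K -> open O -> K `<=` O ->
  exists2 d : R, 0 < d & forall x y, K x -> mdist x y < d -> O y.
Proof.
move=> /compact_near_coveringP cK oO KO.
have H : \forall d \near (0 : R)^'+, forall x, K x -> forall y,
    mdist x y < d -> O y.
  apply: (cK R (0 : R)^'+ (fun d x => forall y, mdist x y < d -> O y)) => x Kx.
  have /nbhs_ballP [r /= r0 Hr] : nbhs x O by apply: open_nbhs_nbhs; split=> //; exact: KO.
  have r2 : 0 < r / 2 by rewrite divr_gt0.
  exists (ball x (r / 2), [set d : R | d < r / 2]).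
    by split; [exact: nbhsx_ballx | exact: nbhs_right_lt].
  move=> [z d] /= [xz dr] y zy.
  apply: Hr; rewrite (splitr r); apply: ball_triangle xz _.
  by rewrite ballE (lt_trans zy).
have [d [d0 Hd]] := filter_ex (filterI (nbhs_right_gt (0 : R)) H).
by exists d => // x y Kx xy; exact: (Hd x Kx y xy).
Qed.

(* Closure in Homeo(U) for the uniform topology. *)
Definition uniform_closure (U : set X) (H : set (homeo U)) : set (homeo U) :=
  [set f | forall e : R, 0 < e ->
    exists2 h, H h & forall w, U w -> mdist (f w) (h w) < e].

Definition homeo_subgroup (U : set X) (H : set (homeo U)) : Prop :=
  [/\ H 1%g, forall f g, H f -> H g -> H (f * g)%g
    & forall f, H f -> H (f^-1)%g].

Lemma uniform_closure_subgroup (U : set X) (H : set (homeo U)) :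
  compact U -> homeo_subgroup H -> homeo_subgroup (uniform_closure H).
Proof.
move=> cU [H1 HM HV]; split.
- by move=> e e0; exists 1%g => // w _; rewrite mdistxx.
- move=> f g cf cg e e0; have e2 : 0 < e / 2 by rewrite divr_gt0.
  have [d d0 Hd] := compact_unif_cont cU (@hm_fun_cont _ _ f) e2.
  have [h1 Hh1 fh1] := cf _ e2; have [h2 Hh2 gh2] := cg _ d0.
  exists (h1 * h2)%g; first exact: HM.
  move=> w Uw; rewrite (splitr e).
  apply: le_lt_trans (metric_triangle _ (f (h2 w)) _) _.
  apply: ltrD; last by apply: fh1; exact: hm_fun_in.
  by apply: Hd; [exact: hm_fun_in..|exact: gh2].
- move=> f cf e e0.
  have [d d0 Hd] := compact_unif_cont cU (@hm_inv_cont _ _ f) e0.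
  have [h Hh fh] := cf _ d0.
  exists (h^-1)%g; first exact: HV.
  move=> w Uw; have Uz := hm_inv_in h Uw.
  have := Hd _ _ (hm_fun_in h Uz) (hm_fun_in f Uz).
  rewrite (hm_funK f) // (hm_invK h) //; apply.
  by have := fh _ Uz; rewrite hm_invK // metric_sym.
Qed.

End CompactMetric.

Definition homeo_restr (X : topologicalType) (U U' : set X) (f : homeo U)
    (U'U : U' `<=` U) (fU' : forall w, U' w -> U' (f w))
    (fVU' : forall w, U' w -> U' (hm_inv f w)) : homeo U'.
Proof.
apply: (@Homeo X U' (fun w => if `[< U' w >] then f w else w)
                    (fun w => if `[< U' w >] then hm_inv f w else w)).
- by move=> w U'w; rewrite asboolT //; exact: fU'.
- by move=> w U'w; rewrite asboolT //; exact: fVU'.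
- move=> w U'w; rewrite (asboolT U'w) asboolT; last exact: fU'.
  by apply: hm_funK; exact: U'U.
- move=> w U'w; rewrite (asboolT U'w) asboolT; last exact: fVU'.
  by apply: hm_invK; exact: U'U.
- apply: (subspace_eq_continuous (f := f)); last first.
    by apply: continuous_subspaceW (@hm_fun_cont _ _ f).
  by move=> w /set_mem U'w; rewrite /from_subspace /= asboolT.
- apply: (subspace_eq_continuous (f := hm_inv f)); last first.
    by apply: continuous_subspaceW (@hm_inv_cont _ _ f).
  by move=> w /set_mem U'w; rewrite /from_subspace /= asboolT.
- by move=> w U'w; rewrite asboolF.
- by move=> w U'w; rewrite asboolF.
Defined.

Lemma homeo_restrE (X : topologicalType) (U U' : set X) (f : homeo U)
    (U'U : U' `<=` U) (fU' : forall w, U' w -> U' (f w))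
    (fVU' : forall w, U' w -> U' (hm_inv f w)) w :
  U' w -> homeo_restr U'U fU' fVU' w = f w.
Proof. by move=> /= /asboolT ->. Qed.

Section AdaptedSets.
Context {R : realType} {n : nat} {M : topologicalType}.
Variable C : regular_covering R n M.
Let X := rc_X C.

Definition adapted (U : set X) (H : set (homeo U)) : Prop :=
  [/\ U !=set0, clopen U, homeo_subgroup H,
      forall V g, Gstar_in U V g <->
        [/\ open V, V `<=` U & exists2 h, H h & forall w, V w -> g w = h w]
    & forall V g, Gstar V g -> U `<=` V ->
        g @` U `<=` U \/ g @` U `&` U = set0].

(* The chain U_1, U_2, ... is indexed from 0.  The group of an adapted set is
   determined by the set, so carrying it in the record adds no choice. *)
Record adapted_basis (x : X) := AdaptedBasis {
  ab_set : nat -> set X ;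
  ab_grp : forall l, set (homeo (ab_set l)) ;
  ab_adapted : forall l, adapted (@ab_grp l) ;
  ab_desc : forall l, ab_set l.+1 `<=` ab_set l ;
  ab_cap : \bigcap_l ab_set l = [set x]
}.

End AdaptedSets.

Arguments ab_grp {R n M C x} a l.
Arguments ab_adapted {R n M C x} a l.
Arguments ab_desc {R n M C x} a l.

Section AsymptoticDiscriminant.
Context {R : realType} {n : nat} {M : topologicalType}.
Context {C : regular_covering R n M} {x : rc_X C}.
Variable B : adapted_basis x.

Lemma ab_mem l : ab_set B l x.
Proof. by have : [set x] x by []; rewrite -(ab_cap B) => /(_ l); exact. Qed.

Lemma ab_compact l : compact (ab_set B l).
Proof.
have [_ cX _ _] := rc_cantor C; have [_ [_ cU] _ _ _] := ab_adapted B l.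
exact: (subclosed_compact cU cX).
Qed.

Definition isotropy (l : nat) : set (homeo (ab_set B l)) :=
  [set f | uniform_closure (ab_grp B l) f /\ f x = x].
Arguments isotropy l : clear implicits.

Lemma isotropy_closed l : group_closed (fun f => f \in isotropy l).
Proof.
have [_ _ sH _ _] := ab_adapted B l.
have [c1 cM cV] := uniform_closure_subgroup (@ab_compact l) sH.
split; first by apply: mem_set; split.
move=> f g If Ig.
have [cf fx] : isotropy l f := set_mem If.
have [cg gx] : isotropy l g := set_mem Ig.
apply: mem_set; split.
  by apply: cM => //; exact: cV.
have gVx : hm_inv g x = x.
  by rewrite -[RHS](hm_funK g (ab_mem l)) gx.
exact: (etrans (congr1 f gVx) fx).
Qed.

(* I(U_1, U_l, x), which depends on U_l and x only. *)
Definition isotropy_group (l : nat) : Type :=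
  {f : homeo (ab_set B l) | f \in isotropy l}.

HB.instance Definition _ l := SubChoice.on (isotropy_group l).
HB.instance Definition _ l := SubChoice_isSubGroup.Build
  (homeo (ab_set B l)) (fun f => f \in isotropy l) (isotropy_group l)
  (isotropy_closed l).

Lemma isotropy_approx l (f : homeo (ab_set B l)) e : isotropy l f -> 0 < e ->
  exists2 h, ab_grp B l h &
    (forall w, ab_set B l w -> mdist (f w) (h w) < e) /\
    (forall w, ab_set B l.+1 w -> ab_set B l.+1 (h w)).
Proof.
move=> [cf fx] e0.
have [_ [oU _] _ HU _] := ab_adapted B l.
have [_ [oU' _] _ _ tU'] := ab_adapted B l.+1.
have [d d0 Hd] := compact_open_ball (@ab_compact l.+1) oU' (@subset_refl _ _).
have m0 : 0 < Num.min d e by rewrite lt_min d0.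
have [h Hh fh] := cf _ m0; exists h => //; split.
  by move=> w Uw; apply: lt_le_trans (fh w Uw) _; rewrite ge_min lexx orbT.
have [Gh _ _] : Gstar_in (ab_set B l) (ab_set B l) h.
  by apply/HU; split=> //; exists h.
have hx : ab_set B l.+1 (h x).
  apply: (Hd x); first exact: ab_mem.
  have := fh x (ab_mem l); rewrite fx => xh.
  by apply: lt_le_trans xh _; rewrite ge_min lexx.
have [sub|dis] := tU' _ _ Gh (ab_desc B l).
  by move=> w Uw; apply: sub; exists w.
have : (h @` ab_set B l.+1 `&` ab_set B l.+1) (h x).
  by split=> //; exists x => //; exact: ab_mem.
by rewrite dis.
Qed.

Lemma isotropy_stable l (f : homeo (ab_set B l)) : isotropy l f ->
  forall w, ab_set B l.+1 w -> ab_set B l.+1 (f w).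
Proof.
move=> If w Uw.
have [_ [oU' _] _ _ _] := ab_adapted B l.+1.
have [d d0 Hd] := compact_open_ball (@ab_compact l.+1) oU' (@subset_refl _ _).
have [h _ [fh hU]] := isotropy_approx If d0.
apply: (Hd (h w)); first exact: hU.
by rewrite metric_sym; apply: fh; exact: ab_desc.
Qed.

Lemma isotropyV l (f : homeo (ab_set B l)) : isotropy l f -> isotropy l (f^-1)%g.
Proof.
move=> If; have [g1 gD] := isotropy_closed l.
by have := set_mem (gD 1%g f g1 (mem_set If)); rewrite div1g.
Qed.

Definition isotropy_restr l (f : homeo (ab_set B l)) (If : isotropy l f) :
    homeo (ab_set B l.+1) :=
  homeo_restr (ab_desc B l) (isotropy_stable If)
    (isotropy_stable (isotropyV If)).

Lemma isotropy_restr_in l (f : homeo (ab_set B l)) (If : isotropy l f) :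
  isotropy l.+1 (isotropy_restr If).
Proof.
split; last by rewrite homeo_restrE; [case: If|exact: ab_mem].
move=> e e0; have [h Hh [fh hU]] := isotropy_approx If e0.
have [_ [oU _] _ HU _] := ab_adapted B l.
have [_ [oU' _] _ HU' _] := ab_adapted B l.+1.
have [[_ [r [cr nr rh]]] _ _] : Gstar_in (ab_set B l) (ab_set B l) h.
  by apply/HU; split=> //; exists h.
have : Gstar_in (ab_set B l.+1) (ab_set B l.+1) h.
  split=> //; last by move=> _ [w Uw <-]; exact: hU.
  split=> //; exists r; split=> // w Uw; apply: rh; exact: ab_desc.
move=> /HU' [_ _ [h' Hh' hh']]; exists h' => // w Uw.
by rewrite homeo_restrE // -hh' //; apply: fh; exact: ab_desc.
Qed.

Definition sigma (l : nat) (f : isotropy_group l) : isotropy_group l.+1 :=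
  exist _ (isotropy_restr (set_mem (valP f)))
    (mem_set (isotropy_restr_in (set_mem (valP f)))).

Lemma sigmaE l (f : isotropy_group l) w :
  ab_set B l.+1 w -> val (sigma f) w = val f w.
Proof. exact: homeo_restrE. Qed.

Lemma sigmaM l : {morph @sigma l : f g / (f * g)%g}.
Proof.
move=> f g; apply/val_inj; apply: homeo_eq => w Uw.
rewrite sigmaE // /= !asboolT //.
apply: isotropy_stable => //; exact: set_mem (valP g).
Qed.

HB.instance Definition _ l := isMultiplicative.Build
  (isotropy_group l) (isotropy_group l.+1) (@sigma l) (@sigmaM l).

End AsymptoticDiscriminant.

Record group_seq := GroupSeq {
  gs_grp :> nat -> groupType ;
  gs_map : forall i, {multiplicative gs_grp i -> gs_grp i.+1}
}.

Definition discriminant_seq (R : realType) (n : nat) (M : topologicalType)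
    (C : regular_covering R n M) (x : rc_X C) (B : adapted_basis x) :
    group_seq :=
  @GroupSeq (fun l => isotropy_group B l) (fun l => @sigma _ _ _ _ _ B l).

Definition gs_surjective (A : group_seq) : Prop :=
  forall i (b : A i.+1), exists a : A i, gs_map A i a = b.

(* [gs_comp a b] for a in A_m and b in A_n means that b is the image of a
   under the composition A_m -> A_(m+1) -> ... -> A_n. *)
Inductive gs_comp (A : group_seq) (m : nat) (a : A m) :
    forall n : nat, A n -> Prop :=
| gs_comp_id : gs_comp a a
| gs_comp_step n (b : A n) : gs_comp a b -> gs_comp a (gs_map A n b).

(* All indices are shifted by one with respect to the usual convention
   C_1, C_2, ...: here A_(p i) and B_(q i) are identified with C_(2i) and
   C_(2i+1).  The condition p_i >= i is invariant under this shift. *)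
Definition tail_equivalent (A B : group_seq) : Prop :=
  [/\ gs_surjective A, gs_surjective B &
  exists (p q : nat -> nat) (C : group_seq)
    (PiA : forall i, {multiplicative A (p i) -> C i.*2})
    (PiB : forall i, {multiplicative B (q i) -> C i.*2.+1}),
  [/\ {homo p : i j / (i < j)%N} /\ (forall i, (i <= p i)%N),
      {homo q : i j / (i < j)%N} /\ (forall i, (i <= q i)%N),
      [/\ gs_surjective C, forall i, bijective (PiA i)
        & forall i, bijective (PiB i)],
      forall i (a : A (p i)) (a' : A (p i.+1)), gs_comp a a' ->
        gs_map C i.*2.+1 (gs_map C i.*2 (PiA i a)) = PiA i.+1 a'
    & forall i (b : B (q i)) (b' : B (q i.+1)), gs_comp b b' ->
        gs_map C i.*2.+2 (gs_map C i.*2.+1 (PiB i b)) = PiB i.+1 b']].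

(* Main.v *)
Require Import Defs.
From HB Require Import structures.
From mathcomp Require Import all_boot all_order all_algebra.
From mathcomp Require Import all_classical all_reals all_analysis.
From mathcomp Require Import ring lra.

Set Implicit Arguments.
Unset Strict Implicit.
Unset Printing Implicit Defensive.

Import Order.TTheory GRing.Theory Num.Theory.
Import numFieldNormedType.Exports.

Local Open Scope classical_set_scope.
Local Open Scope ring_scope.

(** Tail equivalence is proved for two coverings [C] of [M] and [C'] of [M']
    and a homeomorphism [f : M -> M']; independence of all choices on one space
    is the case where [f] is the identity.

    Comparison of the transversals.  A path in a foliated space with totally
    disconnected transversals stays in a leaf, so the homeomorphism [f] maps
    leaves to leaves.  Following the centres of the plaques of [C] through [f]
    into the charts of [C'] gives a map [theta] between the transversals; the
    round trip through the map obtained from the inverse of [f] is locally a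
    holonomy map ([theta_roundtrip]).  The delicate point is uniformity: the
    holonomy pseudogroup consists of compositions of generators and is not
    closed under gluing, so one chain of generators of [C'] must follow a
    generator of [C] near every transverse point, including the boundary points
    of its domain ([generator_transfer]).  This is where convexity of the plaques enters: two
    plaques meet in a connected set, hence determine one transverse germ
    ([overlap_germ]).

    Dynamics.  Compactness turns the local statements into uniform ones.
    Equicontinuity then keeps all translates of a small set small, and
    holonomy maps defined on a small set are carried by [theta] to holonomy maps
    ([hol_transfer]).  A bootstrap along chains shows that equicontinuity does
    not depend on the covering ([hol_equicontinuous_transfer]), and
    connectedness gives minimality ([orbit_meets_clopen]).

    Groups.  By Ascoli the closure of an adapted group is compact, and by
    minimality it acts transitively ([closure_transitive]).  Composing [theta]
    with a holonomy map and an element of such a closure yields a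
    homeomorphism [Th] from a neighbourhood of [x] to a neighbourhood of [x']
    with [Th x = x'].  It need not conjugate the pseudogroups, but it is a
    uniform limit of maps which do ([limit_conjugacy_exists]), and that is
    enough for conjugation by [Th] followed by restriction to be a homomorphism
    between the isotropy groups of the closures.  This homomorphism is
    surjective, again by Ascoli ([transfer_surjective]); the surjectivity of
    the restriction maps inside one sequence is the case where [Th] is the
    identity.  Shrinking the adapted sets alternately on both sides, the
    homomorphisms given by [Th] and by its inverse interleave the two sequences
    ([interleave_tail_equivalent]). *)

(** * Compactness and connectedness *)

(** Connectedness of the segment: a property which is locally constant along
    [0, 1] propagates from one end to the other. *)
Lemma segment_transport (R : realType) (P : R -> Prop) : P 0 ->
  (forall t : R, 0 <= t <= 1 ->
    \forall s \near t, 0 <= s <= 1 -> (P s <-> P t)) -> P 1.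
Proof.
move=> P0 locP.
pose S : set R := [set t | 0 <= t <= 1 /\ P t].
have I01 (t : R) : `[0%R, 1%R]%classic t <-> 0 <= t <= 1.
  by rewrite /= in_itv.
have key (Q : R -> Prop) : (forall t : R, 0 <= t <= 1 ->
    \forall s \near t, 0 <= s <= 1 -> (Q s <-> Q t)) ->
    exists2 C : set R, open C & [set t | 0 <= t <= 1 /\ Q t] = `[0%R, 1%R] `&` C.
  move=> locQ; exists (interior [set s | 0 <= s <= 1 -> Q s]).
    exact: open_interior.
  apply/seteqP; split => t.
    move=> [t01 Qt]; split; first exact/I01.
    by apply: filterS (locQ t t01) => s H s01; exact/(H s01).
  by move=> [/I01 t01 /interior_subset /= Qt]; split => //; exact: Qt.
have SE : S = `[0%R, 1%R]%classic.
  apply: (@segment_connected R 0 1); first by exists 0; rewrite /S /= lexx ler01.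
    exact: key.
  have [|C oC CE] := key (fun t => ~ P t).
    by move=> t t01; apply: filterS (locP t t01) => s H s01; have := H s01; tauto.
  exists (~` C); first exact: open_closedC.
  apply/seteqP; split => t.
    move=> [t01 Pt]; split; first exact/I01.
    move=> Ct; have : (`[0%R, 1%R] `&` C) t by split=> //; exact/I01.
    by rewrite -CE => -[].
  move=> [/I01 t01 nCt]; split => //.
  apply: contrapT => nPt; apply: nCt.
  have : [set t | 0 <= t <= 1 /\ ~ P t] t by [].
  by rewrite CE => -[].
have : S 1 by rewrite SE; apply/I01; rewrite ler01 lexx.
by case.
Qed.

Section MetricLebesgue.
Context {R : realType} {X : metricType R}.

Lemma near_mdist (Y : metricType R) (a : Y) (P : Y -> Prop) : (\forall w \near a, P w) <->
  exists2 d : R, 0 < d & forall w, mdist a w < d -> P w.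
Proof.
split.
  move=> /nbhs_ballP [d /= d0 H]; exists d => // w aw.
  by apply: H; rewrite ballEmdist.
move=> [d d0 H]; apply: ((nbhs_ballP _ _).2); exists d => //= w.
by rewrite ballEmdist; exact: H.
Qed.

Lemma continuous_mdist (Y : metricType R) (f : X -> Y) (a : X) :
  {for a, continuous f} <-> forall e : R, 0 < e ->
    exists2 d : R, 0 < d & forall w, mdist a w < d -> mdist (f a) (f w) < e.
Proof.
split.
  move=> cf e e0; apply/near_mdist.
  by apply: (cf [set y | mdist (f a) y < e]); apply: (near_mdist _ _).2; exists e.
move=> H A /= /near_mdist [e e0 He]; have [d d0 Hd] := H e e0.
by apply/near_mdist; exists d => // w /Hd; exact: He.
Qed.

(** The form in which compactness of the transversals is used: all uniform
    scales below are Lebesgue numbers of a property of small sets that is known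
    near each point. *)
Lemma lebesgue_number (P : set X -> Prop) : compact [set: X] ->
  (forall A B, A `<=` B -> P B -> P A) ->
  (forall a : X, exists2 W : set X, nbhs a W & P W) ->
  exists2 e : R, 0 < e & forall a (A : set X),
    (forall w, A w -> mdist a w < e) -> P A.
Proof.
move=> /compact_near_coveringP cX mono loc.
have H : \forall d \near (0 : R)^'+, forall a : X, setT a ->
    P [set w | mdist a w < d].
  apply: (cX R (0 : R)^'+ (fun d a => P [set w | mdist a w < d])) => a _.
  have [W /near_mdist [r r0 Hr] PW] := loc a.
  have r2 : 0 < r / 2 by rewrite divr_gt0.
  exists ([set w | mdist a w < r / 2], [set d : R | d < r / 2]).
    split; last exact: nbhs_right_lt.
    by apply/near_mdist; exists (r / 2).
  move=> [z d] /= [az dr]; apply: mono PW => w /= zw; apply: Hr.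
  rewrite (splitr r); apply: le_lt_trans (metric_triangle _ z _) _.
  by rewrite ltrD // (lt_trans zw).
have [d [d0 Hd]] := filter_ex (filterI (nbhs_right_gt (0 : R)) H).
by exists d => // a A HA; apply: mono (Hd a I).
Qed.

End MetricLebesgue.

Lemma totally_disconnected_path (X : topologicalType) (R : realType) (f : R -> X) :
  totally_disconnected [set: X] ->
  (forall t : R, 0 <= t <= 1 -> {for t, continuous f}) -> f 0 = f 1.
Proof.
move=> tX cf.
have cI : connected [set f t | t in `[0%R, 1%R]].
  apply: connected_continuous_connected; first exact: segment_connected.
  apply: continuous_in_subspaceT => t; rewrite inE /= in_itv /=; exact: cf.
have sub : [set f t | t in `[0%R, 1%R]] `<=` connected_component [set: X] (f 0).
  apply: connected_component_max => //.
  by exists 0 => //=; rewrite in_itv /= lexx ler01.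
apply/esym.
suff : [set f 0] (f 1) by [].
rewrite -(tX (f 0) I); apply: sub; exists 1 => //=.
by rewrite in_itv /= ler01 lexx.
Qed.

(** * Charts and plaques *)

Section ChartFacts.
Context {R : realType} {n : nat} {M : topologicalType}.
Variable C : regular_covering R n M.
Implicit Types (i j : 'I_(rc_nu C)) (y : M) (v : 'rV[R]_n) (w : rc_X C).
Local Notation c := (@rc_chart R n M C).

Lemma rc_compact : compact [set: rc_X C].
Proof. by have [] := rc_cantor C. Qed.

Lemma rc_totally_disconnected : totally_disconnected [set: rc_X C].
Proof.
have [_ _ _ zX] := rc_cantor C; exact: zero_dimension_totally_disconnected.
Qed.

Lemma open_open_cube (a : R) : open (open_cube n a).
Proof.
rewrite openE => v H.
have H2 (k : 'I_n) : nbhs v [set u : 'rV[R]_n | - a < u ord0 k < a].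
  have nI : nbhs (v ord0 k) `]- a, a[%classic.
    apply: open_nbhs_nbhs; split; first exact: interval_open.
    by rewrite /= in_itv; exact: H.
  have := @coord_continuous R _ _ ord0 k v _ nI.
  rewrite nbhs_filterE.
 apply: (@filterS _ (nbhs v) _) => u /=.
  by rewrite in_itv.
exact: (filter_forall _ H2).
Qed.

Lemma cube0 (a : R) : 0 < a -> open_cube n a 0.
Proof. by move=> a0 i; rewrite mxE oppr_lt0 a0. Qed.

Lemma box_open i : open (open_cube n (2 : R) `*` ch_tr (c i)).
Proof.
have [oT _] := rc_tr_clopen i.
rewrite openE => -[v w] [/= hv hw].
exists (open_cube n (2 : R), ch_tr (c i)) => //=.
by split; apply: open_nbhs_nbhs; split => //; exact: open_open_cube.
Qed.

Lemma ext_open i : open (ch_ext (c i)).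
Proof. by have [[]] := rc_is_chart i. Qed.

Lemma dom_open i : open (ch_dom (c i)).
Proof. by have [[]] := rc_is_chart i. Qed.

Lemma tr_open i : open (ch_tr (c i)).
Proof. by case: (rc_tr_clopen i). Qed.

Lemma closure_ext i y : closure (ch_dom (c i)) y -> ch_ext (c i) y.
Proof. by have [[_ _ _ H] _ _ _ _] := rc_is_chart i; exact: H. Qed.

Lemma dom_ext i y : ch_dom (c i) y -> ch_ext (c i) y.
Proof. by move=> /subset_closure; exact: closure_ext. Qed.

Lemma ext_box i y : ch_ext (c i) y ->
  open_cube n 2 (ch_leaf (c i) y) /\ ch_tr (c i) (ch_proj (c i) y).
Proof. by have [_ [H _ _ _] _ _ _] := rc_is_chart i => /H []. Qed.

Lemma ext_tr i y : ch_ext (c i) y -> ch_tr (c i) (ch_proj (c i) y).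
Proof. by case/ext_box. Qed.

Lemma ch_mapK i y : ch_ext (c i) y ->
  ch_inv (c i) (ch_leaf (c i) y, ch_proj (c i) y) = y.
Proof.
have [_ [_ _ H _] _ _ _] := rc_is_chart i => Ey; rewrite -[RHS](H _ Ey).
by rewrite /ch_leaf /ch_proj; case: (ch_map _ _).
Qed.

Lemma ch_invK i v w : open_cube n (2 : R) v -> ch_tr (c i) w ->
  ch_map (c i) (ch_inv (c i) (v, w)) = (v, w).
Proof. by have [_ [_ _ _ H] _ _ _] := rc_is_chart i => ? ?; exact: H. Qed.

Lemma proj_inv i v w : open_cube n (2 : R) v -> ch_tr (c i) w ->
  ch_proj (c i) (ch_inv (c i) (v, w)) = w.
Proof. by move=> hv hw; rewrite /ch_proj ch_invK. Qed.

Lemma map_continuous i y : ch_ext (c i) y -> {for y, continuous (ch_map (c i))}.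
Proof.
have [[_ oE _ _] _ H _ _] := rc_is_chart i.
by move: H; rewrite continuous_open_subspace // => H Ey; apply: H; rewrite inE.
Qed.

Lemma proj_continuous i y : ch_ext (c i) y -> {for y, continuous (ch_proj (c i))}.
Proof.
by move=> Ey; apply: continuous_comp; [exact: map_continuous|exact: cvg_snd].
Qed.

Lemma leaf_continuous i y : ch_ext (c i) y -> {for y, continuous (ch_leaf (c i))}.
Proof.
by move=> Ey; apply: continuous_comp; [exact: map_continuous|exact: cvg_fst].
Qed.

Lemma inv_continuous i v w : open_cube n (2 : R) v -> ch_tr (c i) w ->
  {for (v, w), continuous (ch_inv (c i))}.
Proof.
have [_ _ _ H _] := rc_is_chart i.
move: H; rewrite continuous_open_subspace; last exact: box_open.
by move=> H Ey tw; apply: H; rewrite inE.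
Qed.

Lemma tr_inj i j w : ch_tr (c i) w -> ch_tr (c j) w -> i = j.
Proof. by move=> h1 h2; apply: rc_tr_disjoint; exists w. Qed.

Definition center i w : M := ch_inv (c i) (0, w).

Lemma center_dom i w : ch_tr (c i) w -> ch_dom (c i) (center i w).
Proof.
move=> tw; have : (open_cube n (1 : R) `*` ch_tr (c i)) (0, w).
  by split=> //; exact: (cube0 ltr01).
rewrite -rc_dom => -[y Dy Ey].
by have := ch_mapK (dom_ext Dy); rewrite /ch_leaf /ch_proj Ey /= /center => ->.
Qed.

Lemma center_proj i w : ch_tr (c i) w -> ch_proj (c i) (center i w) = w.
Proof. by move=> tw; apply: proj_inv => //; exact: (cube0 (ltr0Sn _ _)). Qed.

(** A segment inside a plaque of a small box is sent to a connected subset of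
    [Y], that is to a point.  Applied to the transverse coordinate of another
    chart, or of a chart of another space, this is what makes leaves a purely
    topological notion. *)
Lemma box_plaque_constant (Y : topologicalType) (D : set M) (p : M -> Y) i v0 w0 :
  totally_disconnected [set: Y] -> open D ->
  (forall y, D y -> {for y, continuous p}) ->
  open_cube n (2 : R) v0 -> ch_tr (c i) w0 -> D (ch_inv (c i) (v0, w0)) ->
  exists B W, [/\ nbhs v0 B, nbhs w0 W & forall v v' w, B v -> B v' -> W w ->
    [/\ ch_tr (c i) w, open_cube n (2 : R) v, D (ch_inv (c i) (v, w)) &
        p (ch_inv (c i) (v, w)) = p (ch_inv (c i) (v', w))]].
Proof.
move=> tY oD cp hv0 hw0 D0.
have : nbhs (v0, w0) [set z | (open_cube n (2 : R) `*` ch_tr (c i)) z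
                              /\ D (ch_inv (c i) z)].
  apply: filterI; first by apply: open_nbhs_nbhs; split => //; exact: box_open.
  apply: (inv_continuous hv0 hw0 _ : nbhs _ ((ch_inv (c i)) @^-1` D)).
  by apply: open_nbhs_nbhs; split.
move=> [[B' W] /= [nB nW] H].
have /nbhs_ballP [e /= e0 He] := nB.
exists (ball v0 e), W; split => //; first exact: nbhsx_ballx.
have key v w : ball v0 e v -> W w -> (open_cube n (2 : R) `*` ch_tr (c i)) (v, w)
                              /\ D (ch_inv (c i) (v, w)).
  by move=> Bv Ww; apply: H; split => //=; exact: He.
move=> v v' w Bv Bv' Ww; have [[/= h1 h2] h3] := key _ _ Bv Ww; split => //.
(* the segment from [v] to [v'] stays in the ball, which is convex *)
pose g (t : R) := v + t *: (v' - v).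
have gB (t : R) : 0 <= t <= 1 -> ball v0 e (g t).
  move=> /andP[t0 t1]; rewrite -ball_normE /=.
  have -> : v0 - g t = (1 - t) *: (v0 - v) + t *: (v0 - v').
    by rewrite /g !scalerBl !scalerBr scale1r; apply/matrixP => a b; rewrite !mxE;
      ring.
  move: Bv Bv'; rewrite -!ball_normE /= => Bv Bv'.
  apply: le_lt_trans (ler_normD _ _) _; rewrite !normrZ.
  rewrite ger0_norm ?subr_ge0 // (ger0_norm t0).
  have [->|tn0] := eqVneq t 0; first by rewrite subr0 mul1r mul0r addr0.
  have tp : 0 < t by rewrite lt0r tn0.
  apply: (@lt_le_trans _ _ ((1 - t) * e + t * e)); last by rewrite -mulrDl subrK mul1r.
  apply: ler_ltD; last by rewrite ltr_pM2l.
  by rewrite ler_wpM2l ?subr_ge0 // ltW.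
have := @totally_disconnected_path Y R (fun t => p (ch_inv (c i) (g t, w))) tY.
have -> : g 0 = v by rewrite /g scale0r addr0.
have -> : g 1 = v' by rewrite /g scale1r addrC subrK.
apply => t t01.
have [[/= k1 k2] k3] := key _ _ (gB t t01) Ww.
have cg : {for t, continuous g}.
  rewrite /g; apply: cvgD; first exact: cvg_cst.
  by apply: cvgZr_tmp; exact: cvg_id.
apply: (@continuous_comp _ _ _ (fun t => ch_inv (c i) (g t, w)) p); last exact: cp.
apply: (@continuous_comp _ _ _ (fun t => (g t, w)) (ch_inv (c i))).
  apply: (@cvg_pair _ _ _ (nbhs t) (nbhs (g t)) (nbhs w) _ _ _ g (fun=> w)) => //.
  exact: cvg_cst.
exact: inv_continuous.
Qed.

End ChartFacts.

(** * Holonomy generators and connected overlaps of plaques *)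

Section Holonomy.
Context {R : realType} {n : nat} {M : topologicalType}.
Variable C : regular_covering R n M.
Implicit Types (i j : 'I_(rc_nu C)) (y : M) (v : 'rV[R]_n) (w : rc_X C).
Local Notation c := (@rc_chart R n M C).
Local Notation hol_comp := (@hol_comp R n M C).

Lemma hol_gen_fun i j w a b : hol_gen i j w a -> hol_gen i j w b -> a = b.
Proof.
move=> [y [Di Dj yw ya]] [z [Ei Ej zw zb]].
apply: (@rc_plaque_meet _ _ _ C i j w).
  by exists y; split; split => //; exact: subset_closure.
by exists z; split; split => //; exact: subset_closure.
Qed.

Lemma hol_gen_sym i j w w' : hol_gen i j w w' -> hol_gen j i w' w.
Proof. by move=> [y [? ? ? ?]]; exists y. Qed.

Lemma hol_gen_id i w : ch_tr (c i) w -> hol_gen i i w w.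
Proof.
by move=> tw; exists (center i w); rewrite center_proj //; split => //;
  exact: center_dom.
Qed.

Lemma hol_comp_fun r : hol_comp r -> forall w a b, r w a -> r w b -> a = b.
Proof.
elim=> [i j w a b|{}r s _ IHr _ IHs w a b [w1 [r1 s1]] [w2 [r2 s2]]].
  exact: hol_gen_fun.
by move: s2; rewrite -(IHr _ _ _ r1 r2); exact: IHs.
Qed.

Lemma hol_comp_inv r : hol_comp r ->
  exists2 s, hol_comp s & forall a b, s a b <-> r b a.
Proof.
elim=> [i j|{}r s _ [r' Hr' r'E] _ [s' Hs' s'E]].
  by exists (hol_gen j i); [exact: hol_comp_gen|split; exact: hol_gen_sym].
exists (fun a b => exists w, s' a w /\ r' w b); first exact: hol_comp_comp.
by move=> a b; split => -[w [h1 h2]]; exists w; split; [apply/r'E|apply/s'E|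
  apply/s'E|apply/r'E].
Qed.

Lemma hol_comp_inj r : hol_comp r -> forall a b w, r a w -> r b w -> a = b.
Proof.
move=> /hol_comp_inv [s Hs sE] a b w /sE h1 /sE h2.
exact: (hol_comp_fun Hs h1 h2).
Qed.

(** Openness of the domain and continuity at once, in the form that is stable
    under composition of relations. *)
Lemma hol_comp_near r : hol_comp r -> forall w w' (O : set (rc_X C)),
  r w w' -> nbhs w' O -> \forall v \near w, exists2 v', r v v' & O v'.
Proof.
elim=> [i j|{}r s _ IHr _ IHs] w w' O.
  move=> [y [Di Dj <- <-]] nO.
  have [hv ht] := ext_box (dom_ext Di).
  set u := ch_leaf (c i) y in hv *; set a := ch_proj (c i) y in ht *.
  pose g w := ch_inv (c i) (u, w).
  have ga : g a = y by rewrite /g ch_mapK //; exact: dom_ext.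
  have cg : {for a, continuous g}.
    apply: (@continuous_comp _ _ _ (fun w => (u, w)) (ch_inv (c i))).
      apply: (@cvg_pair _ _ _ (nbhs a) (nbhs u) (nbhs a) _ _ _ (fun=> u) id) => //.
      exact: cvg_cst.
    exact: inv_continuous.
  have nD : nbhs (g a) (ch_dom (c i) `&` ch_dom (c j) `&`
                        (ch_proj (c j)) @^-1` O).
    rewrite ga; apply: filterI; last first.
      by apply: proj_continuous => //; exact: dom_ext.
    by apply: filterI; apply: open_nbhs_nbhs; split => //; exact: dom_open.
  have nT : nbhs a (ch_tr (c i)).
    by apply: open_nbhs_nbhs; split => //; exact: tr_open.
  have cD : nbhs a (g @^-1` _) := cg _ nD.
  apply: filterS2 cD nT => v [[/= Dgi Dgj] Og] tv.
  exists (ch_proj (c j) (g v)) => //; exists (g v); split => //.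
  exact: proj_inv.
move=> [w0 [r1 s1]] nO; have H := IHs _ _ _ s1 nO.
apply: filterS (IHr _ _ _ r1 H) => v [v0 rv [v' sv Ov]].
by exists v' => //; exists v0.
Qed.

Lemma leaf_curve_continuous (gam : R -> M) (t : R) :
  leaf_curve c gam -> 0 <= t <= 1 -> {for t, continuous gam}.
Proof.
move=> H t01; have [k Hk] := H t t01.
have [Dt _ dt _] := nbhs_singleton Hk.
have cl : {for t, continuous (ch_leaf (c k) \o gam)}.
  by apply: differentiable_continuous; apply/derivable1_diffP.
have [hv ht] := ext_box (dom_ext Dt).
pose g s := ch_inv (c k) (ch_leaf (c k) (gam s), ch_proj (c k) (gam t)).
have gt : g t = gam t by rewrite /g ch_mapK //; exact: dom_ext.
have cg : {for t, continuous g}.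
  apply: (@continuous_comp _ _ _
    (fun s => (ch_leaf (c k) (gam s), ch_proj (c k) (gam t))) (ch_inv (c k))).
    apply: (@cvg_pair _ _ _ (nbhs t) (nbhs (ch_leaf (c k) (gam t)))
      (nbhs (ch_proj (c k) (gam t))) _ _ _ (ch_leaf (c k) \o gam)
      (fun=> ch_proj (c k) (gam t))) => //.
    exact: cvg_cst.
  exact: inv_continuous.
suff : gam @ t --> g t by rewrite gt.
apply: cvg_trans cg; apply: near_eq_cvg.
apply: filterS Hk => s [Ds Es _ _].
by rewrite /g -Es ch_mapK //; exact: dom_ext.
Qed.

(** Both plaques are convex for the same leafwise metric, and the shortest
    geodesic between two common points is unique, hence runs inside both. *)
Lemma plaque_meet_connected i j a b y z :
  plaque (c i) a y -> plaque (c i) a z -> plaque (c j) b y -> plaque (c j) b z ->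
  exists gam : R -> M, [/\ gam 0 = y, gam 1 = z,
    forall t : R, 0 <= t <= 1 -> plaque (c i) a (gam t) /\ plaque (c j) b (gam t)
  & forall t : R, 0 <= t <= 1 -> {for t, continuous gam}].
Proof.
move=> iy iz jy jz.
have ta : ch_tr (c i) a by case: iy => /closure_ext /ext_tr h <-.
have tb : ch_tr (c j) b by case: jy => /closure_ext /ext_tr h <-.
have [gam [geo gi _]] := rc_convex ta iy iz.
have [gam' [_ gj uniq]] := rc_convex tb jy jz.
have [[lc g0 g1] _ _] := geo.
exists gam; split => // t t01; last exact: leaf_curve_continuous.
by split; [exact: gi|rewrite (uniq _ geo) //; exact: gj].
Qed.

Lemma proj_neq_near i (z : M) (a : rc_X C) :
  ch_ext (c i) z -> ch_proj (c i) z <> a ->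
  \forall y \near z & w \near a, ch_proj (c i) y <> w.
Proof.
move=> Ei /eqP zna; have [_ _ hX _] := rc_cantor C.
move: (hX); rewrite open_hausdorff => /(_ _ _ zna).
move=> [[U V] /= [Uz Va] [oU oV /eqP UV0]].
exists ((ch_proj (c i)) @^-1` U, V).
  split => /=; first by apply: (proj_continuous Ei); apply: open_nbhs_nbhs;
    split => //; exact: set_mem.
  by apply: open_nbhs_nbhs; split => //; exact: set_mem.
move=> [y w] /= [Uy Vw] yw.
have : (U `&` V) w by split=> //; rewrite -yw.
by rewrite UV0.
Qed.

(** The germ of the transverse change of coordinates is locally constant along
    the intersection of two closed plaques, which is connected; so all common
    points of the plaques define the germ read off at [z0].  Compactness of the
    overlap of the closed chart domains makes the neighbourhood uniform. *)
Lemma overlap_germ i j (z0 : M) : compact [set: M] ->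
  closure (ch_dom (c i)) z0 -> closure (ch_dom (c j)) z0 ->
  \forall w \near ch_proj (c i) z0, forall y,
    closure (ch_dom (c i)) y -> closure (ch_dom (c j)) y -> ch_proj (c i) y = w ->
    ch_proj (c j) y = ch_proj (c j) (ch_inv (c i) (ch_leaf (c i) z0, w)).
Proof.
move=> cM z0i z0j.
set a := ch_proj (c i) z0.
pose H v w := ch_proj (c j) (ch_inv (c i) (v, w)).
pose Q z := \forall w \near a, H (ch_leaf (c i) z) w = H (ch_leaf (c i) z0) w.
have boxes z : ch_ext (c i) z -> ch_ext (c j) z -> ch_proj (c i) z = a ->
    exists B W, [/\ nbhs (ch_leaf (c i) z) B, nbhs a W &
      forall v v' w, B v -> B v' -> W w -> H v w = H v' w].
  move=> zi zj za; have [h1 h2] := ext_box zi.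
  have [] := @box_plaque_constant _ _ _ C (rc_X C) (ch_ext (c j)) (ch_proj (c j))
    i (ch_leaf (c i) z) (ch_proj (c i) z) (@rc_totally_disconnected _ _ _ C) _ _ h1 h2 _.
  - exact: ext_open.
  - by move=> y; exact: proj_continuous.
  - by rewrite ch_mapK.
  move=> B [W [nB nW BW]]; exists B, W; split; rewrite -?za //.
  by move=> v v' w Bv Bv' Ww; have [] := BW v v' w Bv Bv' Ww.
have QK z : closure (ch_dom (c i)) z -> closure (ch_dom (c j)) z ->
    ch_proj (c i) z = a -> Q z.
  move=> zi zj za.
  have bE : ch_proj (c j) z = ch_proj (c j) z0.
    apply: (@rc_plaque_meet _ _ _ C i j a); first by exists z.
    by exists z0.
  have [gam [g0 g1 gK gc]] := @plaque_meet_connected i j a (ch_proj (c j) z0)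
    z0 z (conj z0i erefl) (conj zi za) (conj z0j erefl) (conj zj bE).
  rewrite -g1; apply: (@segment_transport R (fun t => Q (gam t))).
    by rewrite g0; apply: nearW.
  move=> t t01; have [[gi ga] [gj _]] := gK t t01.
  have [B [W [nB nW BW]]] := boxes _ (closure_ext gi) (closure_ext gj) ga.
  have cl : {for t, continuous (ch_leaf (c i) \o gam)}.
    apply: continuous_comp; first exact: gc.
    by apply: leaf_continuous; exact: closure_ext.
  have Bt := nbhs_singleton nB.
  have nb : nbhs t ((ch_leaf (c i) \o gam) @^-1` B) := cl _ nB.
  apply: filterS nb => s /= Bs _; split; apply: filterS2 nW => w Ww <-;
    exact: BW.
(* common points whose transverse coordinate is not [a] stay away from [a] *)
have cK : compact (closure (ch_dom (c i)) `&` closure (ch_dom (c j))).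
  apply: (subclosed_compact _ cM) => //.
  by apply: closedI; exact: closed_closure.
have := (compact_near_coveringP _).1 cK (rc_X C) (nbhs a)
  (fun w y => ch_proj (c i) y = w -> ch_proj (c j) y = H (ch_leaf (c i) z0) w) _ _.
move=> /(_ _)H'; apply: filterS (H' _) => [w Hw y yi yj|z [zi zj]].
  exact: Hw.
have Ei := closure_ext zi; have Ej := closure_ext zj.
have [za|zna] := pselect (ch_proj (c i) z = a).
  have [B [W [nB nW BW]]] := boxes _ Ei Ej za.
  have Qz := QK z zi zj za.
  have nBW : nbhs z ((ch_leaf (c i)) @^-1` B `&` (ch_proj (c i)) @^-1`
     (W `&` [set w | H (ch_leaf (c i) z) w = H (ch_leaf (c i) z0) w])
     `&` ch_ext (c i)).
    apply: filterI; last by apply: open_nbhs_nbhs; split=> //; exact: ext_open.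
    apply: filterI; first exact: (leaf_continuous Ei).
    by apply: (proj_continuous Ei); rewrite za; exact: filterI.
  exists ((ch_leaf (c i)) @^-1` B `&` (ch_proj (c i)) @^-1`
     (W `&` [set w | H (ch_leaf (c i) z) w = H (ch_leaf (c i) z0) w])
     `&` ch_ext (c i), setT); first by split => //; exact: filterT.
  move=> [y w] /= [[[By [Wy Hy]] Ey] _] <-; rewrite -Hy.
  rewrite -{1}(ch_mapK Ey); apply: BW => //; exact: nbhs_singleton.
have := proj_neq_near Ei zna; apply: filterS => -[y w] /= yw /esym wy.
by rewrite wy in yw.
Qed.

End Holonomy.

(** * Following one covering by chains of another *)

Section Transfer.
Context {R : realType} {n n' : nat} {M M' : topologicalType}.
Variables (C : regular_covering R n M) (C' : regular_covering R n' M').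
Variable f : M -> M'.
Hypothesis cf : continuous f.
Implicit Types (i j : 'I_(rc_nu C)) (k l m : 'I_(rc_nu C')) (y : M)
  (a w : rc_X C) (tau : rc_X C -> M).
Local Notation c := (@rc_chart R n M C).
Local Notation c' := (@rc_chart R n' M' C').

Definition trans_coord k y : rc_X C' := ch_proj (c' k) (f y).

(** Two transverse families of points are joined when, near [a], one and the
    same chain of generators of [C'] leads from the first to the second.
    Quantifying over all charts containing the two points at [a] makes the
    relation transitive. *)
Definition joined a (tau1 tau2 : rc_X C -> M) := forall k l,
  ch_dom (c' k) (f (tau1 a)) -> ch_dom (c' l) (f (tau2 a)) ->
  exists2 r', @hol_comp R n' M' C' r' & \forall w \near a,
    r' (trans_coord k (tau1 w)) (trans_coord l (tau2 w)).

Lemma near_dom a tau k : {for a, continuous tau} -> ch_dom (c' k) (f (tau a)) ->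
  \forall w \near a, ch_dom (c' k) (f (tau w)).
Proof.
move=> ct Dk; have H : {for a, continuous (f \o tau)}.
  by apply: continuous_comp => //; exact: cf.
apply: (H (ch_dom (c' k))); apply: open_nbhs_nbhs; split => //; exact: dom_open.
Qed.

Lemma joined_eq a tau1 tau2 m :
  {for a, continuous tau1} -> {for a, continuous tau2} ->
  (\forall w \near a, [/\ ch_dom (c' m) (f (tau1 w)), ch_dom (c' m) (f (tau2 w))
    & trans_coord m (tau1 w) = trans_coord m (tau2 w)]) ->
  joined a tau1 tau2.
Proof.
move=> c1 c2 H k l Dk Dl.
exists (fun b b' => exists v, hol_gen k m b v /\ hol_gen m l v b').
  by apply: hol_comp_comp; exact: hol_comp_gen.
apply: filterS3 (near_dom c1 Dk) (near_dom c2 Dl) H => w D1 D2 [D3 D4 E].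
exists (trans_coord m (tau1 w)); split; first by exists (f (tau1 w)).
by rewrite E; exists (f (tau2 w)).
Qed.

Lemma joined_refl a tau : {for a, continuous tau} -> joined a tau tau.
Proof.
move=> ct; have [m Dm] := rc_cover C' (f (tau a)).
by apply: (@joined_eq _ _ _ m) => //; apply: filterS (near_dom ct Dm).
Qed.

Lemma joined_trans a tau1 tau2 tau3 :
  joined a tau1 tau2 -> joined a tau2 tau3 -> joined a tau1 tau3.
Proof.
move=> H1 H2 k l Dk Dl; have [m Dm] := rc_cover C' (f (tau2 a)).
have [r Hr nr] := H1 k m Dk Dm; have [s Hs ns] := H2 m l Dm Dl.
exists (fun b b' => exists v, r b v /\ s v b'); first exact: hol_comp_comp.
by apply: filterS2 nr ns => w rw sw; exists (trans_coord m (tau2 w)).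
Qed.

Lemma slice_continuous i v a (g : rc_X C -> rc_X C) : {for a, continuous g} ->
  open_cube n (2 : R) v -> ch_tr (c i) (g a) ->
  {for a, continuous (fun w => ch_inv (c i) (v, g w))}.
Proof.
move=> cg hv hg; apply: (@continuous_comp _ _ _ (fun w => (v, g w)) (ch_inv (c i))).
  apply: (@cvg_pair _ _ _ (nbhs a) (nbhs v) (nbhs (g a)) _ _ _ (fun=> v) g) => //.
  exact: cvg_cst.
exact: inv_continuous.
Qed.

Lemma transfer_box i v a : open_cube n (2 : R) v -> ch_tr (c i) a ->
  forall m, ch_dom (c' m) (f (ch_inv (c i) (v, a))) ->
  exists B W, [/\ nbhs v B, nbhs a W & forall v v' w, B v -> B v' -> W w ->
    ch_dom (c' m) (f (ch_inv (c i) (v, w))) /\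
    trans_coord m (ch_inv (c i) (v, w)) = trans_coord m (ch_inv (c i) (v', w))].
Proof.
move=> hv ha m Dm.
have [] := @box_plaque_constant _ _ _ C (rc_X C') (f @^-1` ch_dom (c' m))
  (trans_coord m) i v a (@rc_totally_disconnected _ _ _ C') _ _ hv ha Dm.
- by apply: open_comp; [move=> *; exact: cf|exact: dom_open].
- move=> y Dy; apply: continuous_comp; first exact: cf.
  by apply: proj_continuous; exact: dom_ext.
move=> B [W [nB nW H]]; exists B, W; split => // v1 v2 w B1 B2 Ww.
by have [] := H _ _ _ B1 B2 Ww.
Qed.

(** The segment between two leafwise coordinates runs through boxes on which
    the transverse coordinates of [C'] do not change, so the relation is locally
    constant along it. *)
Lemma joined_slide i v v' a (g : rc_X C -> rc_X C) : {for a, continuous g} ->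
  open_cube n (2 : R) v -> open_cube n (2 : R) v' -> ch_tr (c i) (g a) ->
  joined a (fun w => ch_inv (c i) (v, g w)) (fun w => ch_inv (c i) (v', g w)).
Proof.
move=> cg hv hv' hg.
pose u (t : R) := v + t *: (v' - v).
have -> : v' = u 1 by rewrite /u scale1r addrC subrK.
have hu (t : R) : 0 <= t <= 1 -> open_cube n (2 : R) (u t).
  move=> /andP[t0 t1] e; rewrite /u !mxE.
  have /andP[h1 h2] := hv e; have /andP[h3 h4] := hv' e.
  by case: (lerP (v ord0 e) (v' ord0 e)) => vv'; apply/andP; split; nra.
have cu (t : R) : {for t, continuous u}.
  rewrite /u; apply: cvgD; first exact: cvg_cst.
  by apply: cvgZr_tmp; exact: cvg_id.
apply: (@segment_transport R (fun t => joined a (fun w => ch_inv (c i) (v, g w))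
   (fun w => ch_inv (c i) (u t, g w)))).
  by rewrite /u scale0r addr0; apply: joined_refl; exact: slice_continuous.
move=> t t01; have ht := hu _ t01.
have [m Dm] := rc_cover C' (f (ch_inv (c i) (u t, g a))).
have [B [W [nB nW BW]]] := transfer_box ht hg Dm.
have nb : nbhs t (u @^-1` B) := cu t B nB.
have nw : nbhs a (g @^-1` W) := cg W nW.
have Bt := nbhs_singleton nB.
apply: filterS nb => s /= Bs s01; have hs := hu _ s01.
have J (x z : R) : 0 <= x <= 1 -> 0 <= z <= 1 -> B (u x) -> B (u z) ->
    joined a (fun w => ch_inv (c i) (u x, g w)) (fun w => ch_inv (c i) (u z, g w)).
  move=> x01 z01 Bx Bz; apply: (@joined_eq _ _ _ m).
  - by apply: slice_continuous => //; exact: hu.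
  - by apply: slice_continuous => //; exact: hu.
  - apply: filterS nw => w /= Ww; split.
    + by have [] := BW _ _ _ Bx Bz Ww.
    + by have [] := BW _ _ _ Bz Bx Ww.
    + by have [] := BW _ _ _ Bx Bz Ww.
by split => /joined_trans; apply; exact: J.
Qed.

(** The chain goes from the centre of the first plaque to the common point
    [z0], and from there to the centre of the second plaque.  The section through
    [z0] in the first chart is not a section of the second one, but both agree
    up to the leafwise coordinate, which [transfer_box] ignores. *)
Lemma joined_overlap i j (z0 : M) : compact [set: M] ->
  closure (ch_dom (c i)) z0 -> closure (ch_dom (c j)) z0 ->
  let a := ch_proj (c i) z0 in
  exists h : rc_X C -> rc_X C, [/\ {for a, continuous h}, ch_tr (c j) (h a),
    \forall w \near a, forall w', hol_gen i j w w' -> w' = h w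
  & joined a (center i) (center j \o h)].
Proof.
move=> cM z0i z0j a.
have Ei := closure_ext z0i; have Ej := closure_ext z0j.
have [hv ha] := ext_box Ei; have [hu hb] := ext_box Ej.
set v := ch_leaf (c i) z0 in hv; set u := ch_leaf (c j) z0 in hu.
pose tau w := ch_inv (c i) (v, w).
have ta : tau a = z0 by exact: ch_mapK.
have ct : {for a, continuous tau}.
  by apply: (@slice_continuous i v a id) => //; exact: cvg_id.
have ct' : tau @ a --> z0 by rewrite -ta; exact: ct.
pose h w := ch_proj (c j) (tau w).
have hE : h a = ch_proj (c j) z0 by rewrite /h ta.
have ch : {for a, continuous h}.
  by apply: continuous_comp => //; rewrite ta; exact: proj_continuous.
exists h; split => //; first by rewrite hE.
  apply: filterS (overlap_germ cM z0i z0j) => w H w' [y [Di Dj yw <-]].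
  by apply: H => //; exact: subset_closure.
have J1 : joined a (center i) tau.
  by apply: (@joined_slide i 0 v a id) => //; exact: (cube0 (ltr0Sn _ _)).
apply: (joined_trans J1).
have J2 : joined a (fun w => ch_inv (c j) (u, h w)) (center j \o h).
  by apply: joined_slide; rewrite ?hE //; exact: (cube0 (ltr0Sn _ _)).
apply: (joined_trans _ J2).
have [m Dm] := rc_cover C' (f z0).
have Dm' : ch_dom (c' m) (f (ch_inv (c j) (u, ch_proj (c j) z0))).
  by rewrite ch_mapK.
have [B [W [nB nW BW]]] := transfer_box hu hb Dm'.
apply: (@joined_eq _ _ _ m) => //.
  by apply: slice_continuous => //; rewrite hE.
have n1 : nbhs a (tau @^-1` (ch_ext (c j) `&` (ch_leaf (c j)) @^-1` B)).
  apply: ct'; apply: filterI; last exact: leaf_continuous.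
  by apply: open_nbhs_nbhs; split => //; exact: ext_open.
have n2 : nbhs a (h @^-1` W) by apply: ch; rewrite hE.
apply: filterS2 n1 n2 => w [/= Ew Bw] Ww.
have Bu := nbhs_singleton nB.
have -> : tau w = ch_inv (c j) (ch_leaf (c j) (tau w), h w) by rewrite ch_mapK.
split.
- by have [] := BW _ _ _ Bw Bu Ww.
- by have [] := BW _ _ _ Bu Bu Ww.
- by have [] := BW _ _ _ Bw Bu Ww.
Qed.

(** A transverse point over which the closed chart domains do not meet has a
    neighbourhood disjoint from the domain of the generator; over any other
    point [joined_overlap] applies, even at the boundary of that domain, where
    the generator itself is undefined. *)
Lemma generator_transfer i j a : compact [set: M] ->
  (\forall w \near a, forall w', ~ hol_gen i j w w') \/
  ch_tr (c i) a /\
  exists h : rc_X C -> rc_X C, [/\ {for a, continuous h}, ch_tr (c j) (h a),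
    \forall w \near a, forall w', hol_gen i j w w' -> w' = h w
  & joined a (center i) (center j \o h)].
Proof.
move=> cM.
have [[z0 [z0i z0j <-]]|nz] := pselect (exists z0, [/\ closure (ch_dom (c i)) z0,
    closure (ch_dom (c j)) z0 & ch_proj (c i) z0 = a]).
  right; split; first by apply: ext_tr; exact: closure_ext.
  exact: joined_overlap.
left; have cK : compact (closure (ch_dom (c i)) `&` closure (ch_dom (c j))).
  by apply: (subclosed_compact _ cM) => //; apply: closedI; exact: closed_closure.
have H := (compact_near_coveringP _).1 cK (rc_X C) (nbhs a)
  (fun w y => ch_proj (c i) y <> w) _ _.
apply: filterS (H _ _) => [w Hw w' [y [Di Dj yw _]]|y [yi yj]].
  by apply: (Hw y) => //; split; exact: subset_closure.
by apply: proj_neq_near; [exact: closure_ext|move=> E; apply: nz; exists y].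
Qed.

End Transfer.

(** * The comparison map between two transversals *)

Section BasePoints.
Context {R : realType} {n : nat} {M : topologicalType}.
Variable C : regular_covering R n M.
Implicit Types (i j : 'I_(rc_nu C)) (a w : rc_X C).
Local Notation c := (@rc_chart R n M C).

Definition tr_index w : 'I_(rc_nu C) := sval (cid (rc_tr_cover w)).

Lemma tr_indexP w : ch_tr (c (tr_index w)) w.
Proof. by rewrite /tr_index; case: cid. Qed.

Lemma tr_indexE i w : ch_tr (c i) w -> tr_index w = i.
Proof. by move=> tw; apply: tr_inj tw; exact: tr_indexP. Qed.

Lemma near_tr_index a : \forall w \near a, tr_index w = tr_index a.
Proof.
have : nbhs a (ch_tr (c (tr_index a))).
  by apply: open_nbhs_nbhs; split; [exact: tr_open|exact: tr_indexP].
by apply: filterS => w; exact: tr_indexE.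
Qed.

Definition base w : M := center (tr_index w) w.

Lemma base_dom w : ch_dom (c (tr_index w)) (base w).
Proof. exact/center_dom/tr_indexP. Qed.

Lemma base_proj w : ch_proj (c (tr_index w)) (base w) = w.
Proof. exact/center_proj/tr_indexP. Qed.

Lemma base_continuous : continuous base.
Proof.
move=> a; suff : (center (tr_index a)) @ a --> base a.
  apply: cvg_trans; apply: near_eq_cvg.
  by apply: filterS (near_tr_index a) => w; rewrite /base => ->.
apply: (@slice_continuous _ _ _ C (tr_index a) 0 a id); first exact: cvg_id.
  exact: (cube0 (ltr0Sn _ _)).
exact: tr_indexP.
Qed.

End BasePoints.

Section Codes.
Context {R : realType} {n n' : nat} {M M' : topologicalType}.
Variables (C : regular_covering R n M) (C' : regular_covering R n' M').
Variable f : M -> M'.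
Hypothesis cf : continuous f.
Local Notation c := (@rc_chart R n M C).
Local Notation c' := (@rc_chart R n' M' C').
Implicit Types (a w : rc_X C) (kap : rc_X C -> 'I_(rc_nu C')).

(** A locally constant choice of a chart of [C'] containing the image of each
    base point; local constancy makes the resulting transverse coordinate
    continuous. *)
Definition coded_on (A : set (rc_X C)) kap := forall a, A a ->
  \forall w \near a, kap w = kap a /\ ch_dom (c' (kap w)) (f (base w)).

Lemma coded_on_point a : exists A, [/\ clopen A, A a & exists kap, coded_on A kap].
Proof.
have [k Dk] := rc_cover C' (f (base a)).
have nD : nbhs a [set w | ch_dom (c' k) (f (base w))].
  have cb : {for a, continuous (f \o @base R n M C)}.
    by apply: continuous_comp; [exact: base_continuous|exact: cf].
  by apply: (cb (ch_dom (c' k))); apply: open_nbhs_nbhs; split => //; exact: dom_open.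
have [_ cX hX zX] := rc_cantor C.
have [A [Aa clA] AD] := zero_dimensional_cvg hX zX cX nD.
exists A; split => //; exists (fun=> k) => b Ab.
by apply: filterS (open_nbhs_nbhs (conj (proj1 clA) Ab)) => w /AD.
Qed.

(** Local choices exist on clopen sets, can be glued over unions of two of
    these, and one such set is the whole transversal by compactness, applied to
    the filter of sufficiently large good sets. *)
Lemma exists_code : exists kap, coded_on setT kap.
Proof.
pose good A := clopen A /\ exists kap, coded_on A kap.
have goodU A B : good A -> good B -> good (A `|` B).
  move=> [cA [kA HA]] [cB [kB HB]]; split.
    by case: cA cB => ? ? [? ?]; split; [exact: openU|exact: closedU].
  exists (fun w => if `[< A w >] then kA w else kB w) => a.
  have [Aa _|nAa [//|Ba]] := pselect (A a).
    apply: filterS2 (open_nbhs_nbhs (conj (proj1 cA) Aa)) (HA a Aa) => w Aw.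
    by rewrite !asboolT.
  have oA : open (~` A) by apply: closed_openC; case: cA.
  apply: filterS2 (open_nbhs_nbhs (conj oA nAa)) (HB a Ba) => w Aw.
  by rewrite !asboolF.
pose F : set_system (set (rc_X C)) :=
  [set S | exists2 A0, good A0 & forall A, good A -> A0 `<=` A -> S A].
have FF : Filter F.
  split.
  - exists set0 => //; split; first exact: clopen0.
    by exists (fun w => sval (cid (rc_cover C' (f (base w))))) => a [].
  - move=> S T [A gA HA] [B gB HB]; exists (A `|` B); first exact: goodU.
    move=> D gD sub; split; [apply: HA|apply: HB] => // w ?; apply: sub; by [left|right].
  - by move=> S T ST [A gA HA]; exists A => // B gB AB; apply: ST; exact: HA.
have [A gA HA] : exists2 A0, good A0 & forall A, good A -> A0 `<=` A ->
    setT `<=` (fun w => good A -> A w).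
  apply: ((compact_near_coveringP _).1 (@rc_compact _ _ _ C) _ F
    (fun A w => good A -> A w)) => a _.
  have [A [cA Aa [k Hk]]] := coded_on_point a.
  exists (A, [set B | good B -> A `<=` B]).
    split => /=; first by apply: open_nbhs_nbhs; split => //; case: cA.
    by exists A; [split=> //; exists k|move=> D _ AD _].
  by move=> [w B] /= [Aw AB] gB; exact: AB.
have [_ [kap Hkap]] := gA; exists kap => a _.
by apply: Hkap; exact: (HA A gA (@subset_refl _ _) a I gA).
Qed.

Variable kap : rc_X C -> 'I_(rc_nu C').
Hypothesis kapP : coded_on setT kap.

Definition theta w : rc_X C' := trans_coord f (kap w) (base w).

Lemma near_code a : \forall w \near a, kap w = kap a.
Proof. by apply: filterS (kapP (a := a) I) => w []. Qed.

Lemma code_dom a : ch_dom (c' (kap a)) (f (base a)).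
Proof. by have /nbhs_singleton [] := kapP (a := a) I. Qed.

Lemma theta_continuous : continuous theta.
Proof.
move=> a; have ct : {for a, continuous (trans_coord f (kap a) \o @base R n M C)}.
  apply: continuous_comp; first exact: base_continuous.
  apply: continuous_comp; first exact: cf.
  by apply: proj_continuous; apply: dom_ext; exact: code_dom.
apply: cvg_trans ct; apply: near_eq_cvg.
by apply: filterS (near_code a) => w; rewrite /theta => ->.
Qed.

Lemma theta_generator i j a : compact [set: M] ->
  (\forall w \near a, forall w', ~ hol_gen (C := C) i j w w') \/
  exists h r', [/\ {for a, continuous h}, @hol_comp R n' M' C' r'
    & \forall w \near a, (forall w', hol_gen i j w w' -> w' = h w)
        /\ r' (theta w) (theta (h w))].
Proof.
move=> /(generator_transfer C' cf i j a) [|[ta [h [ch th Hh J]]]]; [by left|right].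
have [] := J (kap a) (kap (h a)).
- by have := code_dom a; rewrite /base (tr_indexE ta).
- by have := code_dom (h a); rewrite /base (tr_indexE th).
move=> r' Hr' nr'; exists h, r'; split => //.
have n1 : nbhs a (h @^-1` [set w | kap w = kap (h a) /\ tr_index w = tr_index (h a)]).
  by apply: ch; apply: filterI; [exact: near_code|exact: near_tr_index].
have n2 : nbhs a [set w | kap w = kap a /\ tr_index w = tr_index a].
  by apply: filterI; [exact: near_code|exact: near_tr_index].
near=> w.
have [k1 t1] : kap (h w) = kap (h a) /\ tr_index (h w) = tr_index (h a).
  by near: w.
have [k2 t2] : kap w = kap a /\ tr_index w = tr_index a by near: w.
split; first by near: w.
rewrite /theta /base k1 t1 k2 t2 (tr_indexE ta) (tr_indexE th).
by near: w.
Unshelve. all: by end_near.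
Qed.

End Codes.

Section Identity.
Context {R : realType} {n : nat} {M : topologicalType}.
Variable C : regular_covering R n M.

Lemma tr_index_code : coded_on (@id M) setT (@tr_index R n M C).
Proof.
move=> a _; apply: filterS (near_tr_index a) => w; split => //.
exact: base_dom.
Qed.

Lemma theta_id w : theta (@id M) (@tr_index R n M C) w = w.
Proof. exact: base_proj. Qed.

End Identity.

Section Roundtrip.
Context {R : realType} {n n' : nat} {M M' : topologicalType}.
Variables (C : regular_covering R n M) (C' : regular_covering R n' M').
Variables (f : M -> M') (f' : M' -> M).
Hypotheses (cf : continuous f) (cf' : continuous f') (fK : cancel f f').
Variables (kap : rc_X C -> 'I_(rc_nu C')) (kap' : rc_X C' -> 'I_(rc_nu C)).
Hypotheses (kapP : coded_on f setT kap) (kapP' : coded_on f' setT kap').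
Local Notation th := (theta f kap).
Local Notation th' := (theta f' kap').

(** The round trip starts at the base point of a plaque of [C], slides inside
    the plaque of [C'] that contains its image to the centre of that plaque,
    and reads the transverse coordinate there: it moves along the leaf, by the
    same chain for all nearby plaques. *)
Lemma theta_roundtrip (a : rc_X C) : exists2 r, @hol_comp R n M C r &
  \forall w \near a, r w (th' (th w)).
Proof.
set k := kap a; set b := th a.
have Dk : ch_dom (rc_chart k) (f (base a)) := code_dom kapP a.
have Ek := dom_ext Dk; have [hu hb] := ext_box Ek.
set u := ch_leaf (rc_chart k) (f (base a)) in hu.
have fa : ch_inv (rc_chart k) (u, b) = f (base a) by exact: ch_mapK.
have tb : tr_index b = k by exact: tr_indexE.
have J : joined C f' b (fun v => ch_inv (rc_chart k) (u, v)) (center k).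
  apply: (@joined_slide _ _ _ _ _ C' C f' cf' k u 0 b id) => //.
  exact: (cube0 (ltr0Sn _ _)).
have Di : ch_dom (rc_chart (tr_index a)) (f' (ch_inv (rc_chart k) (u, b))).
  by rewrite fa fK; exact: base_dom.
have Dl : ch_dom (rc_chart (kap' b)) (f' (center k b)).
  by have := code_dom kapP' b; rewrite /base tb.
have [r Hr nr] := J _ _ Di Dl; exists r => //.
have [B [W [nB nW BW]]] := transfer_box cf' hu hb Di.
have cth := theta_continuous cf kapP (x := a).
have cl : {for a, continuous (fun w => ch_leaf (rc_chart k) (f (base w)))}.
  apply: (@continuous_comp _ _ _ (f \o @base R n M C)).
    by apply: continuous_comp; [exact: base_continuous|exact: cf].
  exact: leaf_continuous.
have nE : nbhs a [set w | ch_dom (rc_chart k) (f (base w))].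
  have cb : {for a, continuous (f \o @base R n M C)}.
    by apply: continuous_comp; [exact: base_continuous|exact: cf].
  by apply: (cb (ch_dom _)); apply: open_nbhs_nbhs; split => //; exact: dom_open.
have n1 : nbhs a (th @^-1` [set v | [/\ W v, kap' v = kap' b, tr_index v = tr_index b
    & r (trans_coord f' (tr_index a) (ch_inv (rc_chart k) (u, v)))
        (trans_coord f' (kap' b) (center k v))]]).
  apply: cth; near=> v; split; first by near: v.
  - by near: v; exact: (near_code kapP').
  - by near: v; exact: near_tr_index.
  - by near: v.
have n2 : nbhs a ((fun w => ch_leaf (rc_chart k) (f (base w))) @^-1` B).
  exact: cl.
near=> w.
have [Ww kw tw rw] : [/\ W (th w), kap' (th w) = kap' b, tr_index (th w) = tr_index b
    & r (trans_coord f' (tr_index a) (ch_inv (rc_chart k) (u, th w)))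
        (trans_coord f' (kap' b) (center k (th w)))] by near: w.
have Bw : B (ch_leaf (rc_chart k) (f (base w))) by near: w.
have kaw : kap w = k by near: w; exact: (near_code kapP).
have iw : tr_index w = tr_index a by near: w; exact: near_tr_index.
have Dw : ch_dom (rc_chart k) (f (base w)) by near: w.
have -> : th' (th w) = trans_coord f' (kap' b) (center k (th w)).
  by rewrite {1}/theta /base kw tw tb.
suff E : trans_coord f' (tr_index a) (ch_inv (rc_chart k) (u, th w)) = w.
  by move: rw; rewrite E.
have [_ <-] := BW _ _ _ Bw (nbhs_singleton nB) Ww.
have -> : th w = ch_proj (rc_chart k) (f (base w)) by rewrite /theta kaw.
rewrite ch_mapK; last exact: dom_ext.
by rewrite /trans_coord fK -iw base_proj.
Unshelve. all: by end_near.
Qed.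

End Roundtrip.


(** * Uniform estimates and dynamics *)

Section UniformInverse.
Context {R : realType} {X Y : metricType R}.

Lemma uniform_continuity (f : X -> Y) : compact [set: X] -> continuous f ->
  forall e : R, 0 < e -> exists2 d : R, 0 < d &
    forall a b, mdist a b < d -> mdist (f a) (f b) < e.
Proof.
move=> cX cf e e0; have e2 : 0 < e / 2 by rewrite divr_gt0.
have [||d d0 Hd] := @lebesgue_number R X
    (fun A => forall a b, A a -> A b -> mdist (f a) (f b) < e) cX.
- by move=> A B AB HB a b /AB Ba /AB Bb; exact: HB.
- move=> a; exists [set w | mdist (f a) (f w) < e / 2].
    by apply: (cf a [set y | mdist (f a) y < e / 2]); apply: (near_mdist _ _).2;
      exists (e / 2).
  move=> u v /= fu fv; rewrite (splitr e).
  apply: le_lt_trans (metric_triangle _ (f a) _) _.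
  by rewrite ltrD // metric_sym.
exists d => // a b ab; apply: (Hd a [set w | mdist a w < d]) => //=.
by rewrite mdistxx.
Qed.

(** On the compact set of pairs at distance at most [d / 2], the only pairs
    identified by [f] are the diagonal ones, so pairs far from the diagonal have
    images bounded apart.  Halving [d] leaves room for the pairs nearby. *)
Lemma uniform_inverse (f : X -> Y) (d : R) : compact [set: X] -> continuous f ->
  0 < d -> (forall a b, mdist a b < d -> f a = f b -> a = b) ->
  forall e : R, 0 < e -> exists2 eta : R, 0 < eta &
    forall a b, mdist a b < d / 2 -> mdist (f a) (f b) < eta -> mdist a b < e.
Proof.
move=> cX cf d0 inj e e0.
have cXX : compact [set: X * X].
  by rewrite -setXTT; exact: compact_setX.
have H : \forall eta \near (0 : R)^'+, setT `<=` (fun p : X * X =>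
    mdist p.1 p.2 < d / 2 -> mdist (f p.1) (f p.2) < eta -> mdist p.1 p.2 < e).
  apply: ((compact_near_coveringP _).1 cXX R (0 : R)^'+ (fun eta p =>
    mdist p.1 p.2 < d / 2 -> mdist (f p.1) (f p.2) < eta -> mdist p.1 p.2 < e)).
  move=> [a b] _ /=.
  have nb (s : R) : 0 < s -> nbhs (a, b) [set p : X * X | mdist a p.1 < s /\
      mdist b p.2 < s].
    move=> s0; exists ([set w | mdist a w < s], [set w | mdist b w < s]) => //=.
    by split; apply: (near_mdist _ _).2; exists s.
  have tri (s : R) (p : X * X) : mdist a p.1 < s /\ mdist b p.2 < s ->
      mdist a b < s + s + mdist p.1 p.2 /\ mdist p.1 p.2 < s + s + mdist a b.
    move=> [h1 h2].
    have := metric_triangle a p.1 b; have := metric_triangle p.1 p.2 b.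
    have := metric_triangle p.1 a p.2; have := metric_triangle a b p.2.
    by rewrite (metric_sym p.1 a) (metric_sym p.2 b); split; lra.
  have [fab|fab] := eqVneq (f a) (f b).
    have [ab|ab] := ltP (mdist a b) d.
      have := inj _ _ ab fab => E; have e2 : 0 < e / 2 by rewrite divr_gt0.
      exists ([set p : X * X | mdist a p.1 < e / 2 /\ mdist b p.2 < e / 2], setT).
        by split => /=; [exact: nb|exact: filterT].
      move=> [p eta] /= [/tri [_ +] _] _ _; rewrite E mdistxx addr0.
      by move=> h; lra.
    have e2 : 0 < d / 4 by rewrite divr_gt0.
    exists ([set p : X * X | mdist a p.1 < d / 4 /\ mdist b p.2 < d / 4], setT).
      by split => /=; [exact: nb|exact: filterT].
    by move=> [p eta] /= [/tri [h _] _] h1 _; lra.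
  have D0 : 0 < mdist (f a) (f b).
    by rewrite lt_neqAle mdist_ge0 andbT eq_sym; apply: contra fab => /eqP/mdist_positivity ->.
  set D := mdist (f a) (f b) in D0.
  have D4 : 0 < D / 4 by rewrite divr_gt0.
  exists ([set p : X * X | mdist (f a) (f p.1) < D / 4 /\
     mdist (f b) (f p.2) < D / 4], [set eta : R | eta < D / 2]).
    split => /=; last by apply: nbhs_right_lt; rewrite divr_gt0.
    exists ([set w | mdist (f a) (f w) < D / 4], [set w | mdist (f b) (f w) < D / 4]) => //=.
    split.
      by apply: (cf a [set y | mdist (f a) y < D / 4]); apply: (near_mdist _ _).2; exists (D / 4).
    by apply: (cf b [set y | mdist (f b) y < D / 4]); apply: (near_mdist _ _).2; exists (D / 4).
  move=> [[p q] eta] /= [[h1 h2] h3] _ h4; exfalso.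
  have := metric_triangle (f a) (f p) (f b); have := metric_triangle (f p) (f q) (f b).
  by rewrite (metric_sym (f q) (f b)) -/D; lra.
have [eta [eta0 Heta]] := filter_ex (filterI (nbhs_right_gt (0 : R)) H).
by exists eta => // a b; exact: (Heta (a, b) I).
Qed.

End UniformInverse.

Section Equicontinuity.
Context {R : realType} {n : nat} {M : topologicalType}.
Variable C : regular_covering R n M.
Local Notation hol := (@hol_comp R n M C).
Implicit Types (A : set (rc_X C)) (a w v : rc_X C).

Lemma hol_id_small : exists2 e : R, 0 < e & forall a A,
  (forall w, A w -> mdist a w < e) -> exists2 r, hol r & forall w, A w -> r w w.
Proof.
apply: (lebesgue_number (P := fun A => exists2 r, hol r & forall w, A w -> r w w)
  (@rc_compact _ _ _ C)).
  by move=> A B AB [r Hr rB]; exists r => // w /AB; exact: rB.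
move=> a; exists (ch_tr (rc_chart (tr_index a))).
  by apply: open_nbhs_nbhs; split; [exact: tr_open|exact: tr_indexP].
by exists (hol_gen (tr_index a) (tr_index a)); [exact: hol_comp_gen|
  move=> w; exact: hol_gen_id].
Qed.

(** Equicontinuity stated for the relations, so that it applies to sets that
    are not open, in particular to pairs of points. *)
Definition hol_equicontinuous :=
  forall e : R, 0 < e -> exists2 d : R, 0 < d &
  forall r, hol r -> forall w v w' v', r w w' -> r v v' ->
    mdist w v < d -> mdist w' v' < e.

Lemma equicontinuous_coveringW : equicontinuous_covering C -> hol_equicontinuous.
Proof.
move=> H e e0; have [d d0 Hd] := H e e0; exists d => // r Hr w v w' v' ww' vv' wv.
have [g gP] : exists g : rc_X C -> rc_X C, forall w, (exists w', r w w') -> r w (g w).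
  have /choice [g Hg] : forall w, exists w', (exists w', r w w') -> r w w'.
    by move=> u; have [[u' H']|nH] := pselect (exists u', r u u');
      [exists u'|exists u].
  by exists g.
pose V := [set w | exists w', r w w'].
have G : Gstar V g.
  split.
    rewrite openE => u [u' uu'].
    by apply: filterS (hol_comp_near Hr uu' filterT) => x [x' xx' _]; exists x'.
  by exists r; split => //; exists w, w'.
have Vw : V w by exists w'.
have Vv : V v by exists v'.
have := Hd V g G w v Vw Vv wv.
by rewrite -(hol_comp_fun Hr ww' (gP w Vw)) -(hol_comp_fun Hr vv' (gP v Vv)).
Qed.

End Equicontinuity.

Section Dynamics.
Context {R : realType} {n n' : nat} {M M' : topologicalType}.
Variables (C : regular_covering R n M) (C' : regular_covering R n' M').
Variable f : M -> M'.
Hypotheses (cf : continuous f) (cM : compact [set: M]).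
Variable kap : rc_X C -> 'I_(rc_nu C').
Hypothesis kapP : coded_on f setT kap.
Local Notation th := (theta f kap).
Local Notation hol := (@hol_comp R n M C).
Local Notation hol' := (@hol_comp R n' M' C').
Implicit Types (A : set (rc_X C)) (a w v : rc_X C).

(** Only generators whose domain meets [A] are considered: then the chain is
    defined on all of [A], even where the generator is not. *)
Definition carried A := forall i j, (exists w w', A w /\ hol_gen i j w w') ->
  exists h r', hol' r' /\ forall w, A w ->
    (forall w', hol_gen i j w w' -> w' = h w) /\ r' (th w) (th (h w)).

(** There are finitely many pairs of charts, so that the neighbourhoods
    given by [theta_generator] for all of them can be intersected. *)
Lemma carried_small : exists2 e : R, 0 < e & forall a A,
  (forall w, A w -> mdist a w < e) -> carried A.
Proof.
apply: (lebesgue_number (P := carried) (@rc_compact _ _ _ C)).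
  move=> A B AB HB i j [w [w' [Aw ww']]].
  have [|h [r' [Hr' H]]] := HB i j; first by exists w, w'; split => //; exact: AB.
  by exists h, r'; split => // v /AB; exact: H.
move=> a.
have /choice [W HW] : forall p : 'I_(rc_nu C) * 'I_(rc_nu C), exists W : set (rc_X C),
    nbhs a W /\ ((exists w w', W w /\ hol_gen p.1 p.2 w w') ->
    exists h r', hol' r' /\ forall w, W w ->
    (forall w', hol_gen p.1 p.2 w w' -> w' = h w) /\ r' (th w) (th (h w))).
  move=> [i j] /=; have [H|[h [r' [_ Hr' H]]]] := theta_generator cf kapP i j a cM.
    by eexists; split; [exact: H|move=> [w [w' [/= Hw]]] /Hw].
  by eexists; split; [exact: H|move=> _; exists h, r'].
exists [set w | forall p, W p w].
  by apply: (filter_forall _) => p; case: (HW p).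
move=> i j [w [w' [Ww ww']]]; have [_ H] := HW (i, j).
have [|h [r' [Hr' H']]] := H; first by exists w, w'; split => //; exact: (Ww (i, j)).
by exists h, r'; split => // v Wv; apply: H'; exact: (Wv (i, j)).
Qed.

Lemma generator_equicontinuous (e : R) : 0 < e ->
  exists2 d : R, 0 < d & forall i j w v w' v', mdist w v < d ->
    hol_gen (C := C) i j w w' -> hol_gen i j v v' -> mdist w' v' < e.
Proof.
move=> e0; have e2 : 0 < e / 2 by rewrite divr_gt0.
pose P A := forall i j w v w' v', A w -> A v ->
    hol_gen (C := C) i j w w' -> hol_gen i j v v' -> mdist w' v' < e.
have [||d d0 Hd] := lebesgue_number (P := P) (@rc_compact _ _ _ C).
- by move=> A B AB HB i j w v w' v' /AB Bw /AB Bv; exact: HB.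
- move=> a.
  have /choice [W HW] : forall p : 'I_(rc_nu C) * 'I_(rc_nu C), exists W : set (rc_X C),
    nbhs a W /\ forall w v w' v', W w -> W v ->
      hol_gen p.1 p.2 w w' -> hol_gen p.1 p.2 v v' -> mdist w' v' < e.
    move=> [i j] /=; have [H|[h [r' [ch _ H]]]] := theta_generator cf kapP i j a cM.
      by eexists; split; [exact: H|move=> w v w' v' Hw _ /Hw].
    have nh : nbhs a (h @^-1` [set w | mdist (h a) w < e / 2]).
      by apply: ch; apply: (near_mdist _ _).2; exists (e / 2).
    eexists; split; first exact: (filterI H nh).
    move=> w v w' v' [[Hw _] hw] [[Hv _] hv] /Hw -> /Hv ->; rewrite (splitr e).
    apply: le_lt_trans (metric_triangle _ (h a) _) _.
    by rewrite ltrD // metric_sym.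
  exists [set w | forall p, W p w].
    by apply: (filter_forall _) => p; case: (HW p).
  move=> i j w v w' v' Ww Wv; have [_ H] := HW (i, j).
  by apply: H; [exact: (Ww (i, j))|exact: (Wv (i, j))].
exists d => // i j w v w' v' wv; apply: (Hd w [set x | mdist w x < d]) => //=.
by rewrite mdistxx.
Qed.

(** By equicontinuity every translate of a small set is still small enough for
    [carried_small], so the chains following the successive generators can be
    composed. *)
Lemma hol_transfer : hol_equicontinuous C ->
  exists2 d : R, 0 < d & forall a A, (forall w, A w -> mdist a w < d) -> A a ->
    forall r, hol r -> (forall w, A w -> exists w', r w w') ->
    exists2 r', hol' r' & forall w w', A w -> r w w' -> r' (th w) (th w').
Proof.
move=> equi; have [e1 e10 He1] := carried_small; have [d1 d10 Hd1] := equi _ e10.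
have [d2 d20 Hd2] := hol_id_small C.
exists (Num.min d1 d2); first by rewrite lt_min d10.
move=> a A HA Aa.
pose img (q : rc_X C -> rc_X C -> Prop) := [set v | exists2 w, A w & q w v].
(* [q] is the part of the composition already performed *)
have key r : hol r -> forall q, hol q -> (forall w, A w -> exists w', q w w') ->
    (forall w, img q w -> exists w', r w w') ->
    exists2 r', hol' r' & forall w w', img q w -> r w w' -> r' (th w) (th w').
  move=> Hr; elim: r / Hr => [i j|r s Hr IHr Hs IHs] q Hq Dq Dr.
    have [b qab] := Dq a Aa.
    have sm w : img q w -> mdist b w < e1.
      move=> [v Av qvw]; apply: (Hd1 q Hq a v) => //.
      by apply: lt_le_trans (HA v Av) _; rewrite ge_min lexx.
    have [|h [r' [Hr' H]]] := He1 b (img q) sm i j.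
      have Ib : img q b by exists a.
      by have [b' bb'] := Dr b Ib; exists b, b'.
    by exists r' => // w w' /H [Hw rw] /Hw ->.
  have [|r' Hr' H1] := IHr q Hq Dq.
    by move=> w /Dr [w' [v [rv _]]]; exists v.
  have [|||s' Hs' H2] := IHs (fun w w' => exists v, q w v /\ r v w').
  - exact: hol_comp_comp.
  - move=> w Aw; have [v qv] := Dq w Aw.
    have [|v' [u [ru _]]] := Dr v; first by exists w.
    by exists u, v.
  - move=> w [v Av [u [qvu ruw]]].
    have [|x [y [ruy sy]]] := Dr u; first by exists v.
    by exists x; rewrite (hol_comp_fun Hr ruw ruy).
  exists (fun b b' => exists z, r' b z /\ s' z b'); first exact: hol_comp_comp.
  move=> w w' iw [v [rv sv]]; exists (th v); split; first exact: H1.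
  by apply: H2 => //; case: iw => u Au qu; exists u => //; exists w.
move=> r Hr Dr.
have [q Hq qE] : exists2 q, hol q & forall w, A w -> q w w.
  apply: (Hd2 a) => w Aw; apply: lt_le_trans (HA w Aw) _.
  by rewrite ge_min lexx orbT.
have [|w [v Av qvw]|r' Hr' H] := key r Hr q Hq.
- by move=> w /qE; exists w.
- by rewrite -(hol_comp_fun Hq (qE v Av) qvw); exact: Dr.
exists r' => // w w' Aw; apply: H; by exists w => //; exact: qE.
Qed.

(** A holonomy map is injective, and the round trip is one near each point. *)
Lemma theta_injective_small (f' : M' -> M) (kap' : rc_X C' -> 'I_(rc_nu C)) :
  continuous f' -> cancel f f' -> coded_on f' setT kap' ->
  exists2 d : R, 0 < d & forall a b, mdist a b < d -> th a = th b -> a = b.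
Proof.
move=> cf' fK kapP'.
have [||d d0 Hd] := @lebesgue_number R (rc_X C) (fun A => forall a b, A a -> A b ->
   th a = th b -> a = b) (@rc_compact _ _ _ C).
- by move=> A B AB HB a b /AB Ba /AB Bb; exact: HB.
- move=> a; have [r Hr nr] := theta_roundtrip cf cf' fK kapP kapP' a.
  eexists; first exact: nr.
  move=> u v /= ru rv E; rewrite E in ru.
  exact: (hol_comp_inj Hr ru rv).
exists d => // a b ab; apply: (Hd a [set w | mdist a w < d]) => //=.
by rewrite mdistxx.
Qed.

(** Along a chain of generators of [C], two nearby points are followed by one chain of the equicontinuous covering, so
    that their images stay close there; since they move by a small amount in
    each step, they cannot leave the scale on which the comparison map is
    injective. *)
Lemma hol_equicontinuous_transfer (f' : M' -> M) (kap' : rc_X C' -> 'I_(rc_nu C)) :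
  continuous f' -> cancel f f' -> coded_on f' setT kap' ->
  hol_equicontinuous C' -> hol_equicontinuous C.
Proof.
move=> cf' fK kapP' equi' e e0.
have cX := @rc_compact _ _ _ C.
have cth := theta_continuous cf kapP.
have [d3 d30 inj] := theta_injective_small cf' fK kapP'.
have [e1 e10 He1] := carried_small.
have d32 : 0 < d3 / 2 by rewrite divr_gt0.
have [d4 d40 Hd4] := generator_equicontinuous d32.
have [m [m0 me me1 md4]] : exists m, [/\ 0 < m, m <= e, m <= e1 & m <= d4].
  exists (Num.min e (Num.min e1 d4)).
  by rewrite !lt_min e0 e10 d40; split; rewrite // !ge_min ?lexx ?orTb ?orbT.
have [eta eta0 Heta] := uniform_inverse cX cth d30 inj m0.
have [d5 d50 Hd5] := equi' _ eta0.
have [d6 d60 Hd6] := uniform_continuity cX cth d50.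
have [d7 d70 Hd7] := hol_id_small C'.
have [d8 d80 Hd8] := uniform_continuity cX cth d70.
have [d [d0 dm dd6 dd8]] : exists d, [/\ 0 < d, d <= m, d <= d6 & d <= d8].
  exists (Num.min m (Num.min d6 d8)).
  by rewrite !lt_min m0 d60 d80; split; rewrite // !ge_min ?lexx ?orTb ?orbT.
exists d => //.
move=> r Hr a b a' b' aa' bb' ab.
have thab : mdist (th a) (th b) < d5 by apply: Hd6; exact: lt_le_trans dd6.
(* the invariant carried along a chain starting at [a] and [b] *)
pose St w v := mdist w v < m /\ exists2 q', hol' q' & q' (th a) (th w) /\ q' (th b) (th v).
have key s : hol s -> forall w v w' v', St w v -> s w w' -> s v v' -> St w' v'.
  move=> Hs; elim: s / Hs => [i j|s t _ IHs _ IHt] w v w' v'; last first.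
    move=> Sw [x [sx tx]] [y [sy ty]].
    exact: IHt (IHs _ _ _ _ Sw sx sy) tx ty.
  move=> [wv [q' Hq' [q1 q2]]] ww' vv'.
  (* the two points form a small set, so one chain follows both *)
  have sm x : [set w; v] x -> mdist w x < e1.
    by move=> [->|->]; [rewrite mdistxx|exact: lt_le_trans me1].
  have [|h [r' [Hr' H]]] := He1 w [set w; v] sm i j.
    by exists w, w'; split => //; left.
  have [Hw rw] := H w (or_introl erefl); have [Hv rv] := H v (or_intror erefl).
  have Hqr : hol' (fun x y => exists z, q' x z /\ r' z y) by exact: hol_comp_comp.
  have qrw : exists z, q' (th a) z /\ r' z (th w').
    by exists (th w); rewrite (Hw _ ww').
  have qrv : exists z, q' (th b) z /\ r' z (th v').
    by exists (th v); rewrite (Hv _ vv').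
  split; last by eexists; [exact: Hqr|split].
  apply: Heta; first by apply: Hd4 ww' vv'; exact: lt_le_trans md4.
  exact: (Hd5 _ Hqr _ _ _ _ qrw qrv).
suff [] : St a' b' by move=> /lt_le_trans /(_ me).
apply: (key r Hr a b a' b' _ aa' bb'); split; first exact: lt_le_trans dm.
have [|q Hq qE] := Hd7 (th a) [set th a; th b]; last first.
  by exists q => //; split; apply: qE; [left|right].
move=> w [->|->]; first by rewrite mdistxx.
by apply: Hd8; exact: lt_le_trans dd8.
Qed.

End Dynamics.

Section Minimality.
Context {R : realType} {n : nat} {M : topologicalType}.
Variable C : regular_covering R n M.
Hypotheses (cM : compact [set: M]) (equi : hol_equicontinuous C).
Local Notation hol := (@hol_comp R n M C).
Implicit Types (a w v : rc_X C).

(** The case of [carried_small] in which both coverings are [C] replaces each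
    generator by a chain defined on a whole small set; equicontinuity keeps the
    images of the ball small until the end of the chain.  The extension may use
    another chain than [r]. *)
Lemma uniform_domain : exists2 d : R, 0 < d & forall r, hol r -> forall w w',
  r w w' -> exists2 s, hol s & s w w' /\
    forall v, mdist w v < d -> exists v', s v v'.
Proof.
have cid : continuous (@id M) by move=> x; exact: cvg_id.
have codeP := @tr_index_code _ _ _ C.
have [e1 e10 He1] := carried_small cid cM codeP.
have [d1 d10 Hd1] := equi e10.
have [d2 d20 Hd2] := hol_id_small C.
exists (Num.min d1 d2); first by rewrite lt_min d10.
move=> r Hr w w' ww'; set d := Num.min d1 d2.
have key s : hol s -> forall q v v', hol q -> q w v ->
    (forall x, mdist w x < d -> exists x', q x x') -> s v v' ->
    exists2 t, hol t & t w v' /\ forall x, mdist w x < d -> exists x', t x x'.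
  move=> Hs; elim: s / Hs => [i j|s t _ IHs _ IHt] q v v' Hq qwv Dq; last first.
    move=> [x [sx tx]]; have [q1 Hq1 [q1x Dq1]] := IHs _ _ _ Hq qwv Dq sx.
    exact: IHt _ _ _ Hq1 q1x Dq1 tx.
  move=> vv'; pose A := [set y | exists2 x, mdist w x < d & q x y].
  have Av : A v by exists w => //; rewrite mdistxx lt_min d10.
  have [||h [r' [Hr' H]]] := He1 v A _ i j.
  - move=> y [x wx qxy]; apply: (Hd1 q Hq w x) => //.
    by apply: lt_le_trans wx _; rewrite ge_min lexx.
  - by exists v, v'.
  exists (fun x y => exists z, q x z /\ r' z y); first exact: hol_comp_comp.
  split.
    by exists v; split => //; have [/(_ _ vv') -> +] := H v Av; rewrite !theta_id.
  move=> x wx; have [y qxy] := Dq x wx.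
  have Ay : A y by exists x.
  have [_ +] := H y Ay; rewrite !theta_id => ryz.
  by exists (h y); exists y.
have [q Hq qE] : exists2 q, hol q & forall x, mdist w x < d -> q x x.
  apply: (Hd2 w [set x | mdist w x < d]) => x /= wx.
  by apply: lt_le_trans wx _; rewrite ge_min lexx orbT.
apply: (key r Hr q w w') => //; first by apply: qE; rewrite mdistxx lt_min d10.
by move=> x /qE; exists x.
Qed.

(** Minimality: the set of points whose orbit meets a clopen set is open, is
    closed by [uniform_domain], and is invariant, so it saturates to an open and
    closed subset of the connected space. *)
Lemma orbit_meets_clopen (U : set (rc_X C)) : connected [set: M] ->
  clopen U -> U !=set0 -> forall w, exists2 r, hol r & exists2 w', U w' & r w w'.
Proof.
move=> conM [oU cU] [u Uu].
pose S := [set w | exists2 r, hol r & exists2 w', U w' & r w w'].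
have Sopen w : S w -> \forall v \near w, S v.
  move=> [r Hr [w' Uw' ww']].
  apply: filterS (hol_comp_near Hr ww' (open_nbhs_nbhs (conj oU Uw'))) => v [v' vv' Uv'].
  by exists r => //; exists v'.
have Sclosed w : ~ S w -> \forall v \near w, ~ S v.
  move=> nSw.
  have cUc : compact U by apply: subclosed_compact cU (@rc_compact _ _ _ C) _.
  have [e e0 He] := compact_open_ball cUc oU (@subset_refl _ _).
  have [d1 d10 Hd1] := equi e0; have [d2 d20 Hd2] := uniform_domain.
  apply: (near_mdist _ _).2; exists (Num.min d1 d2); first by rewrite lt_min d10.
  move=> v wv [r Hr [v' Uv' vv']]; apply: nSw.
  have [s Hs [sv Ds]] := Hd2 r Hr v v' vv'.
  rewrite metric_sym in wv.
  have [|w' ww'] := Ds w; first by apply: lt_le_trans wv _; rewrite ge_min lexx orbT.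
  exists s => //; exists w' => //; apply: (He v' w') => //.
  apply: (Hd1 s Hs v w) => //.
  by apply: lt_le_trans wv _; rewrite ge_min lexx.
have Sinv i j w w' : hol_gen i j w w' -> S w' -> S w.
  move=> ww' [r Hr [x Ux w'x]].
  exists (fun a b => exists v, hol_gen i j a v /\ r v b).
    by apply: hol_comp_comp => //; exact: hol_comp_gen.
  by exists x => //; exists w'.
pose SM := [set y | exists2 i, ch_dom (rc_chart i) y & S (ch_proj (rc_chart (r := C) i) y)].
have SMall i y : SM y -> ch_dom (rc_chart i) y -> S (ch_proj (rc_chart (r := C) i) y).
  by move=> [j Dj Sj] Di; apply: (Sinv i j) Sj; exists y.
have near_proj (P : rc_X C -> Prop) i y : ch_dom (rc_chart i) y ->
    (\forall w \near ch_proj (rc_chart i) y, P w) ->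
    \forall z \near y, ch_dom (rc_chart i) z /\ P (ch_proj (rc_chart i) z).
  move=> Di H; apply: filterI.
    by apply: open_nbhs_nbhs; split => //; exact: dom_open.
  exact: (proj_continuous (dom_ext Di) H).
have SMT : SM = setT.
  apply: conM.
  - exists (base u); exists (tr_index u); first exact: base_dom.
    rewrite base_proj; exists (hol_gen (tr_index u) (tr_index u)).
      exact: hol_comp_gen.
    by exists u => //; apply: hol_gen_id; exact: tr_indexP.
  - exists SM; last by rewrite setTI.
    rewrite openE => y [i Di Si].
    by apply: filterS (near_proj _ _ _ Di (Sopen _ Si)) => z [Dz Sz]; exists i.
  - exists SM; last by rewrite setTI.
    rewrite -openC openE => y nSy; have [i Di] := rc_cover C y.
    have nSi : ~ S (ch_proj (rc_chart i) y) by move=> Si; apply: nSy; exists i.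
    apply: filterS (near_proj _ _ _ Di (Sclosed _ nSi)) => z [Dz nSz] /SMall.
    by move=> /(_ _ Dz).
move=> w; have : SM (base w) by rewrite SMT.
by move=> /SMall /(_ (base_dom w)); rewrite base_proj.
Qed.

End Minimality.

(** * Limits of homeomorphisms *)

Section UniformLimits.
Context {R : realType} {X : metricType R}.

Lemma mdist_small_eq (a b : X) : (forall e : R, 0 < e -> mdist a b < e) -> a = b.
Proof.
move=> H; apply/mdist_positivity/eqP; rewrite eq_le mdist_ge0 andbT.
by rewrite leNgt; apply/negP => /H; rewrite ltxx.
Qed.

Definition uniformly_continuous_on (Y : metricType R) (V : set X) (f : X -> Y) :=
  forall e : R, 0 < e -> exists2 d : R, 0 < d & forall u v, V u -> V v ->
    mdist u v < d -> mdist (f u) (f v) < e.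

Lemma uniformly_continuous_within (V : set X) (f : X -> X) :
  uniformly_continuous_on V f -> {within V, continuous f}.
Proof.
move=> H; apply/subspace_continuousP => a Va A /near_mdist [e e0 He].
have [d d0 Hd] := H e e0.
apply: (near_mdist _ _).2; exists d => // w aw Vw.
by apply: He; apply: Hd.
Qed.

Variable U : set X.
Hypothesis cU : compact U.

Lemma clopen_thick (W : set X) : compact W -> open W ->
  exists2 d : R, 0 < d & forall a b, mdist a b < d -> W a <-> W b.
Proof.
move=> cW oW; have [d d0 H] := compact_open_ball cW oW (@subset_refl _ _).
exists d => // a b ab; split; first by move=> Wa; apply: H ab.
by move=> Wb; apply: (H b) => //; rewrite metric_sym.
Qed.

(** Pointwise limits along an ultrafilter exist by compactness, and
    equicontinuity makes the convergence uniform. *)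
Lemma ultra_uniform_limit (T : Type) (G : set_system T) (ev : T -> X -> X)
    (D : set T) :
  UltraFilter G -> G D -> (forall t w, D t -> U w -> U (ev t w)) ->
  (forall e : R, 0 < e -> exists2 d : R, 0 < d & forall t, D t ->
    forall u v, U u -> U v -> mdist u v < d -> mdist (ev t u) (ev t v) < e) ->
  exists f : X -> X, [/\ forall w, U w -> U (f w), uniformly_continuous_on U f &
    forall e : R, 0 < e -> G [set t | forall w, U w -> mdist (f w) (ev t w) < e]].
Proof.
move=> ultraG GD evU equi.
have PG : ProperFilter G := @ultra_proper _ _ ultraG.
have gI A B : G A -> G B -> G (A `&` B) by move=> a b; exact: filterI.
have gex A : G A -> A !=set0 by exact: filter_ex.
have /choice [f Hf] : forall w, exists p, U w -> U p /\
    forall e : R, 0 < e -> G [set t | mdist p (ev t w) < e].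
  move=> w; have [Uw|nUw] := pselect (U w); last by exists w.
  have FU : G [set t | U (ev t w)] by apply: filterS GD => t Dt; exact: (evU t w).
  have cF : cluster (ev^~ w @ G) `&` U !=set0.
    by have [p [Up Fp]] := @cU (ev^~ w @ G) _ FU; exists p.
  have [p [Fp Up]] := cF.
  exists p => _; split => // e e0.
  have [//|nGe] := in_ultra_setVsetC [set t | mdist p (ev t w) < e] ultraG.
  have nB : nbhs p [set y | mdist p y < e] by apply: (near_mdist _ _).2; exists e.
  by have [y []] := Fp (~` [set y | mdist p y < e]) _ nGe nB.
have fU w : U w -> U (f w) by move=> /Hf [].
have fuc : uniformly_continuous_on U f.
  move=> e e0; have e3 : 0 < e / 3 by rewrite divr_gt0.
  have [d d0 Hd] := equi _ e3; exists d => // u v Uu Uv uv.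
  have := gI _ _ (gI _ _ ((Hf u Uu).2 _ e3) ((Hf v Uv).2 _ e3)) GD.
  move=> /gex [t [[/= h1 h2] Dt]].
  have h3 := Hd t Dt u v Uu Uv uv.
  have := metric_triangle (f u) (ev t u) (f v).
  have := metric_triangle (ev t u) (ev t v) (f v).
  by rewrite (metric_sym (ev t v) (f v)); lra.
exists f; split => // e e0.
have e3 : 0 < e / 3 by rewrite divr_gt0.
have [d d0 Hd] := equi _ e3; have [d' d'0 Hd'] := fuc _ e3.
have H : \forall t \near G, U `<=` (fun w => U w -> mdist (f w) (ev t w) < e).
  apply: ((compact_near_coveringP _).1 cU T G
    (fun t w => U w -> mdist (f w) (ev t w) < e)) => a Ua.
  exists ([set w | mdist a w < Num.min d d'], D `&` [set t | mdist (f a) (ev t a) < e / 3]).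
    split => /=.
      by apply: (near_mdist _ _).2; exists (Num.min d d') => //; rewrite lt_min d0.
    by apply: filterI => //; exact: (Hf a Ua).2.
  move=> [w t] /= [aw [Dt h1]] Uw.
  move: aw; rewrite lt_min => /andP[aw aw'].
  have h2 := Hd t Dt a w Ua Uw aw; have h3 := Hd' a w Ua Uw aw'.
  have := metric_triangle (f w) (f a) (ev t w).
  have := metric_triangle (f a) (ev t a) (ev t w).
  by rewrite (metric_sym (f w) (f a)); lra.
by apply: filterS H => t Ht w Uw; exact: Ht.
Qed.

(** Ascoli: an equicontinuous group of homeomorphisms of a compact set is
    relatively compact, so that ever stronger conditions, each satisfied by some
    element of the group, have a common limit.  The group property provides
    the limit of the inverses, which is the inverse of the limit. *)
Lemma uniform_closure_cluster (H : set (homeo U)) (S : R -> set (homeo U)) :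
  homeo_subgroup H ->
  (forall e : R, 0 < e -> exists2 d : R, 0 < d & forall h : homeo U, H h ->
    forall u v, U u -> U v -> mdist u v < d -> mdist (h u) (h v) < e) ->
  (forall e : R, 0 < e -> S e !=set0) -> (forall e, S e `<=` H) ->
  (forall e e', e <= e' -> S e `<=` S e') ->
  exists2 f, uniform_closure H f & forall e : R, 0 < e ->
    exists2 h, S e h & forall w, U w -> mdist (f w) (h w) < e.
Proof.
move=> [_ _ HV] equi S0 SH Smono.
pose F0 : set_system (homeo U) := [set T | exists2 e : R, 0 < e & S e `<=` T].
have PF0 : ProperFilter F0.
  split.
    by move=> [e e0 Se]; have [h /Se] := S0 e e0.
  split.
  - by exists 1.
  - move=> A B [a a0 HA] [b b0 HB]; exists (Num.min a b); first by rewrite lt_min a0.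
    move=> h Sh; split; [apply: HA|apply: HB]; apply: (Smono (Num.min a b)) => //;
      by rewrite ge_min lexx ?orbT.
  - by move=> A B AB [e e0 HA]; exists e => // h /HA; exact: AB.
have [G [uG F0G]] := ultraFilterLemma PF0.
have PG : ProperFilter G := @ultra_proper _ _ uG.
have gI A B : G A -> G B -> G (A `&` B) by move=> a b; exact: filterI.
have gex A : G A -> A !=set0 by exact: filter_ex.
have GS (e : R) : 0 < e -> G (S e) by move=> e0; apply: F0G; exists e.
have GH : G H by apply: filterS (GS _ ltr01); exact: SH.
have [f [fU fuc fG]] := ultra_uniform_limit (ev := fun (h : homeo U) w => h w) uG GH
  (fun h w _ => @hm_fun_in _ _ h w) equi.
have equiV (e : R) : 0 < e -> exists2 d : R, 0 < d & forall h : homeo U, H h ->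
    forall u v, U u -> U v -> mdist u v < d -> mdist (hm_inv h u) (hm_inv h v) < e.
  move=> e0; have [d d0 Hd] := equi e e0; exists d => // h Hh.
  exact: (Hd _ (HV _ Hh)).
have [g [gU guc gG]] := ultra_uniform_limit (ev := fun h : homeo U => hm_inv h) uG GH
  (fun h w _ => @hm_inv_in _ _ h w) equiV.
have fgK w : U w -> f (g w) = w.
  move=> Uw; apply: mdist_small_eq => e e0; have e2 : 0 < e / 2 by rewrite divr_gt0.
  have [d d0 Hd] := equi _ e2.
  have /gex [h [[/= h1 h2] Hh]] := gI _ _ (gI _ _ (fG _ e2) (gG _ d0)) GH.
  have := Hd h Hh _ _ (gU _ Uw) (hm_inv_in h Uw) (h2 w Uw).
  rewrite hm_invK //; have := h1 _ (gU _ Uw).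
  by have := metric_triangle (f (g w)) (h (g w)) w; lra.
have gfK w : U w -> g (f w) = w.
  move=> Uw; apply: mdist_small_eq => e e0; have e2 : 0 < e / 2 by rewrite divr_gt0.
  have [d d0 Hd] := equiV _ e2.
  have /gex [h [[/= h1 h2] Hh]] := gI _ _ (gI _ _ (fG _ d0) (gG _ e2)) GH.
  have := Hd h Hh _ _ (fU _ Uw) (hm_fun_in h Uw) (h1 w Uw).
  rewrite hm_funK //; have := h2 _ (fU _ Uw).
  by have := metric_triangle (g (f w)) (hm_inv h (f w)) w; lra.
pose ext (k : X -> X) w := if `[< U w >] then k w else w.
have extE k w : U w -> ext k w = k w by rewrite /ext => /asboolT ->.
have extN k w : ~ U w -> ext k w = w by rewrite /ext => /asboolF ->.
have cext k : uniformly_continuous_on U k -> {within U, continuous (ext k)}.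
  move=> kc; apply: uniformly_continuous_within => e e0; have [d d0 Hd] := kc e e0.
  by exists d => // u v Uu Uv uv; rewrite !extE //; exact: Hd.
have fh1 w : U w -> U (ext f w) by move=> Uw; rewrite extE //; exact: fU.
have fh2 w : U w -> U (ext g w) by move=> Uw; rewrite extE //; exact: gU.
have fh3 w : U w -> ext g (ext f w) = w.
  by move=> Uw; rewrite (extE f) // extE ?gfK //; exact: fU.
have fh4 w : U w -> ext f (ext g w) = w.
  by move=> Uw; rewrite (extE g) // extE ?fgK //; exact: gU.
pose fh : homeo U := Homeo fh1 fh2 fh3 fh4 (cext f fuc) (cext g guc)
   (fun w => extN f w) (fun w => extN g w).
have lim (e : R) : 0 < e -> exists2 h, S e h & forall w, U w -> mdist (fh w) (h w) < e.
  move=> e0; have /gex [h [/= h1 h2]] := gI _ _ (GS e e0) (fG e e0).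
  by exists h => // w Uw; rewrite /fh /= extE //; exact: h2.
by exists fh => // e e0; have [h /SH Hh fhh] := lim e e0; exists h.
Qed.

End UniformLimits.

Section LimitConjugacy.
Context {R : realType} {n n' : nat} {M M' : topologicalType}.
Variables (C : regular_covering R n M) (C' : regular_covering R n' M').
Local Notation X := (rc_X C).
Local Notation X' := (rc_X C').


Definition inverse_on (V : set X) (V' : set X') (phi : X -> X') (phi' : X' -> X) :=
  (forall w, V w -> V' (phi w) /\ phi' (phi w) = w) /\
  (forall w', V' w' -> V (phi' w') /\ phi (phi' w') = w').

(** Holonomy maps cannot be glued, so a single composition of generators has to
    serve all of [A] on both sides; [A] need not be open. *)
Definition intertwines (V : set X) (phi : X -> X') := forall (A : set X) (k : X -> X),
  A `<=` V -> (forall w, A w -> V (k w)) ->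
  (exists2 r, @hol_comp R n M C r & forall w, A w -> r w (k w)) <->
  (exists2 r', @hol_comp R n' M' C' r' & forall w, A w -> r' (phi w) (phi (k w))).

(** A homeomorphism between transverse sets which need not conjugate the two
    holonomy pseudogroups itself, but is a uniform limit of maps that do: this
    suffices to conjugate the closures of the adapted groups, and is available
    between any two points. *)
Definition limit_conjugacy (V : set X) (V' : set X') (Th : X -> X') (Th' : X' -> X) :=
  [/\ inverse_on V V' Th Th', uniformly_continuous_on V Th,
      uniformly_continuous_on V' Th' &
      forall e : R, 0 < e -> exists phi phi', [/\ inverse_on V V' phi phi',
        forall w, V w -> mdist (phi w) (Th w) < e,
        forall w', V' w' -> mdist (phi' w') (Th' w') < e & intertwines V phi]].
End LimitConjugacy.

Section LimitConjugacyInverse.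
Context {R : realType} {n n' : nat} {M M' : topologicalType}.
Variables (C : regular_covering R n M) (C' : regular_covering R n' M').

Lemma inverse_on_sym V V' (phi : rc_X C -> rc_X C') phi' :
  inverse_on V V' phi phi' -> inverse_on V' V phi' phi.
Proof. by case. Qed.

Lemma intertwines_sym V V' (phi : rc_X C -> rc_X C') phi' :
  inverse_on V V' phi phi' -> intertwines V phi -> intertwines V' phi'.
Proof.
move=> [i1 i2] H A k AV kV.
have [||h1 h2] := H (phi' @` A) (phi' \o k \o phi).
- by move=> _ [w Aw <-]; have [] := i2 _ (AV w Aw).
- by move=> _ [w Aw <-] /=; rewrite (i2 _ (AV w Aw)).2; have [] := i2 _ (kV w Aw).
split.
  move=> [r Hr rA]; have [|s Hs sA] := h2.
    exists r => // _ [w Aw <-] /=.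
    by rewrite !(i2 _ (AV w Aw)).2 (i2 _ (kV w Aw)).2; exact: rA.
  exists s => // w Aw; have := sA (phi' w); rewrite /= (i2 _ (AV w Aw)).2; apply.
  by exists w.
move=> [r Hr rA]; have [|s Hs sA] := h1.
  by exists r => // _ [w Aw <-] /=; rewrite (i2 _ (AV w Aw)).2; exact: rA.
exists s => // w Aw; have := sA (phi' w).
by rewrite /= !(i2 _ (AV w Aw)).2 (i2 _ (kV w Aw)).2; apply; exists w.
Qed.

Lemma limit_conjugacy_sym V V' (Th : rc_X C -> rc_X C') Th' :
  limit_conjugacy V V' Th Th' -> limit_conjugacy V' V Th' Th.
Proof.
move=> [h1 h2 h3 h4]; split => //; first exact: inverse_on_sym.
move=> e e0; have [phi [phi' [i1 i2 i3 i4]]] := h4 e e0.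
exists phi', phi; split => //; first exact: inverse_on_sym.
exact: intertwines_sym i1 i4.
Qed.

Lemma limit_conjugacy_id (V : set (rc_X C)) : limit_conjugacy V V id id.
Proof.
have uid : uniformly_continuous_on V id by move=> e e0; exists e.
split=> // e e0; exists id, id; split => // w _; by rewrite mdistxx.
Qed.

End LimitConjugacyInverse.

(** * Conjugation of isotropy groups *)

Section Bases.
Context {R : realType} {n : nat} {M : topologicalType}.
Context {C : regular_covering R n M} {x : rc_X C}.
Variable B : adapted_basis x.
Local Notation hol := (@hol_comp R n M C).

Lemma ab_sub l m : (l <= m)%N -> ab_set B m `<=` ab_set B l.
Proof.
move=> /subnK <-; elim: (m - l)%N => [|k IH]; first by rewrite add0n.
by rewrite addSn; apply: subset_trans IH; exact: ab_desc.
Qed.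

Lemma ab_open l : open (ab_set B l).
Proof. by have [_ []] := ab_adapted B l. Qed.

(** Each point other than [x] has a neighbourhood missed by all late sets, and
    the transversal is compact. *)
Lemma ab_small (O : set (rc_X C)) : nbhs x O ->
  exists N, forall l, (N <= l)%N -> ab_set B l `<=` O.
Proof.
move=> nO.
have H : \forall l \near \oo, setT `<=` (fun w => ab_set B l w -> O w).
  apply: ((compact_near_coveringP _).1 (@rc_compact _ _ _ C) nat \oo
    (fun l w => ab_set B l w -> O w)) => a _.
  have [->|ax] := pselect (a = x).
    exists (O, setT); first by split => //; exact: filterT.
    by move=> [w l] /= [Ow _] _.
  have [k nUk] : exists k, ~ ab_set B k a.
    apply: contrapT => nk; apply: ax.
    have : (\bigcap_l ab_set B l) a.
      by move=> k _; apply: contrapT => nUk; apply: nk; exists k.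
    by rewrite (ab_cap B).
  exists (~` ab_set B k, [set l | (k <= l)%N]).
    split => /=; last exact: nbhs_infty_ge.
    apply: open_nbhs_nbhs; split => //; apply: closed_openC.
    by have [_ []] := ab_adapted B k.
  by move=> [w l] /= [nw kl] /(ab_sub kl).
have [N _ HN] := H; exists N => l Nl w; exact: HN.
Qed.

Lemma Gstar_intro (W : set (rc_X C)) g : open W ->
  (exists2 r, hol r & forall w, W w -> r w (g w)) -> Gstar W g.
Proof.
move=> oW [r Hr rW]; split => //.
have [[w Ww]|W0] := pselect (W !=set0).
  by exists r; split => //; exists w, (g w); exact: rW.
exists (hol_gen (tr_index x) (tr_index x)); split; first exact: hol_comp_gen.
  by exists x, x; apply: hol_gen_id; exact: tr_indexP.
by move=> w Ww; exfalso; apply: W0; exists w.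
Qed.

Lemma ab_grp_hol l (h : homeo (ab_set B l)) : ab_grp B l h ->
  exists2 r, hol r & forall w, ab_set B l w -> r w (h w).
Proof.
move=> Hh; have [_ [oU _] _ HU _] := ab_adapted B l.
have [[_ [r [Hr _ rU]]] _ _] : Gstar_in (ab_set B l) (ab_set B l) h.
  by apply/HU; split => //; exists h.
by exists r.
Qed.

Lemma ab_grp_extend l (W : set (rc_X C)) g : open W -> W `<=` ab_set B l ->
  (forall w, W w -> ab_set B l (g w)) ->
  (exists2 r, hol r & forall w, W w -> r w (g w)) ->
  exists2 h, ab_grp B l h & forall w, W w -> g w = h w.
Proof.
move=> oW WU gU gr; have [_ _ _ HU _] := ab_adapted B l.
have [|_ _ [h Hh hE]] := (HU W g).1; last by exists h.
split => //; first exact: Gstar_intro.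
by move=> _ [w Ww <-]; exact: gU.
Qed.

Lemma ab_grp_equi l : hol_equicontinuous C -> forall e : R, 0 < e ->
  exists2 d : R, 0 < d & forall h : homeo (ab_set B l), ab_grp B l h ->
    forall u v, ab_set B l u -> ab_set B l v -> mdist u v < d -> mdist (h u) (h v) < e.
Proof.
move=> equi e e0; have [d d0 Hd] := equi e e0; exists d => // h Hh u v Uu Uv uv.
have [r Hr rU] := ab_grp_hol Hh.
exact: Hd Hr _ _ _ _ (rU u Uu) (rU v Uv) uv.
Qed.

Lemma homeo_uniform l (h : homeo (ab_set B l)) : uniformly_continuous_on (ab_set B l) h.
Proof.
move=> e e0; apply: (compact_unif_cont _ _ e0); first exact: ab_compact.
exact: hm_fun_cont.
Qed.

Lemma ab_thick l : exists2 d : R, 0 < d & forall a b, mdist a b < d ->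
  ab_set B l a <-> ab_set B l b.
Proof. exact: clopen_thick (@ab_compact _ _ _ _ _ B l) (@ab_open l). Qed.

End Bases.

Section IsotropyTransfer.
Context {R : realType} {n n' : nat} {M M' : topologicalType}.
Context {C : regular_covering R n M} {C' : regular_covering R n' M'}.
Context {x : rc_X C} {x' : rc_X C'}.
Variables (B : adapted_basis x) (B' : adapted_basis x').
Context {V : set (rc_X C)} {V' : set (rc_X C')}.
Context {Th : rc_X C -> rc_X C'} {Th' : rc_X C' -> rc_X C}.
Hypotheses (lc : limit_conjugacy V V' Th Th') (Thx : Th x = x').
Variables (l m : nat).
Local Notation U := (ab_set B l).
Local Notation U' := (ab_set B' m).
Hypotheses (UV : U `<=` V) (UV' : U' `<=` V').
Hypothesis ThU : forall w', U' w' -> U (Th' w').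

Let invTh : inverse_on V V' Th Th'.
Proof. by case: lc. Qed.

Let ThK w : V w -> Th' (Th w) = w.
Proof. by move=> Vw; have [] := invTh.1 w Vw. Qed.

Let ThK' w' : V' w' -> Th (Th' w') = w'.
Proof. by move=> Vw; have [] := invTh.2 w' Vw. Qed.

Let Thx' : Th' x' = x.
Proof. by rewrite -Thx ThK //; apply: UV; exact: ab_mem. Qed.

Local Notation conj f := (fun w' => Th (f (Th' w'))).

(** Conjugating by maps that intertwine the holonomy and converge to [Th]
    produces elements of the second adapted group, because the conjugates
    nearly fix [x'] and so cannot move the adapted set off itself. *)
Lemma isotropy_conj_approx (f : homeo U) : isotropy f -> forall e : R, 0 < e ->
  exists2 h', ab_grp B' m h' & forall w', U' w' -> mdist (Th (f (Th' w'))) (h' w') < e.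
Proof.
move=> [cf fx] e e0.
have [_ ucTh _ approx] := lc.
have [t t0 Ht] := ab_thick B l; have [t' t'0 Ht'] := ab_thick B' m.
pose e1 := Num.min e t'; have e10 : 0 < e1 by rewrite lt_min e0.
have [e1e e1t] : e1 <= e /\ e1 <= t' by split; rewrite /e1 ge_min lexx ?orbT.
have e12 : 0 < e1 / 2 by rewrite divr_gt0.
have [d1 d10 Hd1] := ucTh _ e12; have d12 : 0 < d1 / 2 by rewrite divr_gt0.
have [d2 d20 Hd2] := homeo_uniform f d12.
have [h Hh fh] := cf _ d12.
have [s [s0 st s2 se]] : exists s, [/\ 0 < s, s <= t, s <= d2 & s <= e1 / 2].
  exists (Num.min t (Num.min d2 (e1 / 2))).
  by rewrite !lt_min t0 d20 e12; split; rewrite // !ge_min ?lexx ?orTb ?orbT.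
have [phi [phi' [iphi phiTh phiTh' inter]]] := approx _ s0.
have phiU w' : U' w' -> U (phi' w').
  move=> Uw; apply: (Ht _ (Th' w') _).2; last exact: ThU.
  by apply: lt_le_trans st; apply: phiTh'; exact: UV'.
pose g w' := phi (h (phi' w')).
have gclose w' : U' w' -> mdist (Th (f (Th' w'))) (g w') < e1.
  move=> Uw.
  have h1 : mdist (f (Th' w')) (f (phi' w')) < d1 / 2.
    apply: Hd2; [exact: ThU|exact: phiU|].
    by rewrite metric_sym; apply: lt_le_trans s2; apply: phiTh'; exact: UV'.
  have h2 := fh _ (phiU _ Uw).
  have h3 : mdist (f (Th' w')) (h (phi' w')) < d1.
    by have := metric_triangle (f (Th' w')) (f (phi' w')) (h (phi' w')); lra.
  have Vf : V (f (Th' w')) by apply: UV; apply: hm_fun_in; exact: ThU.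
  have Vh : V (h (phi' w')) by apply: UV; apply: hm_fun_in; exact: phiU.
  have h4 := Hd1 _ _ Vf Vh h3.
  have h5 : mdist (phi (h (phi' w'))) (Th (h (phi' w'))) < e1 / 2.
    exact: lt_le_trans (phiTh _ Vh) se.
  have := metric_triangle (Th (f (Th' w'))) (Th (h (phi' w'))) (g w').
  by rewrite (metric_sym (Th (h _)) (g w')) /g; lra.
have [r' Hr' gr'] : exists2 r', hol_comp r' & forall w', U' w' -> r' w' (g w').
  have [||H _] := inter (phi' @` U') h.
  - by move=> _ [w' Uw <-]; apply: UV; exact: phiU.
  - by move=> _ [w' Uw <-]; apply: UV; apply: hm_fun_in; exact: phiU.
  have [|r' Hr' rA] := H.
    have [r Hr rU] := ab_grp_hol Hh.
    by exists r => // _ [w' Uw <-]; apply: rU; exact: phiU.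
  exists r' => // w' Uw; have := rA (phi' w').
  by rewrite (iphi.2 _ (UV' Uw)).2; apply; exists w'.
have [_ _ _ _ tU'] := ab_adapted B' m.
have Gg : Gstar U' g by apply: (@Gstar_intro _ _ _ C' x'); [exact: ab_open|exists r'].
have gx : U' (g x').
  apply: (Ht' x' _ _).1; last exact: ab_mem.
  have := gclose x' (ab_mem B' m); rewrite Thx' fx Thx => H.
  exact: lt_le_trans H e1t.
have gU : forall w', U' w' -> U' (g w').
  have [sub|dis] := tU' U' g Gg (@subset_refl _ _).
    by move=> w' Uw; apply: sub; exists w'.
  have : (g @` U' `&` U') (g x') by split => //; exists x' => //; exact: ab_mem.
  by rewrite dis.
have [h' Hh' gh'] := ab_grp_extend (@ab_open _ _ _ _ _ B' m) (@subset_refl _ _) gU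
  (ex_intro2 _ _ r' Hr' gr').
by exists h' => // w' Uw; rewrite -gh' //; apply: lt_le_trans (gclose _ Uw) e1e.
Qed.

Lemma isotropy_conj_in (f : homeo U) : isotropy f ->
  forall w', U' w' -> U' (Th (f (Th' w'))).
Proof.
move=> If w' Uw; have [t t0 Ht] := ab_thick B' m.
have [h' _ fh] := isotropy_conj_approx If t0.
by apply: (Ht _ _ (fh _ Uw)).2; exact: hm_fun_in.
Qed.

Lemma isotropy_conj_uniform (f : homeo U) : uniformly_continuous_on U' (conj f).
Proof.
move=> e e0; have [_ ucTh ucTh' _] := lc.
have [d1 d10 H1] := ucTh _ e0; have [d2 d20 H2] := homeo_uniform f d10.
have [d3 d30 H3] := ucTh' _ d20; exists d3 => // u v Uu Uv uv.
apply: H1; [apply: UV; apply: hm_fun_in; exact: ThU..|].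
by apply: H2; [exact: ThU..|apply: H3 => //; exact: UV'].
Qed.

Definition isotropy_conj_fun (f : homeo U) (w' : rc_X C') : rc_X C' :=
  if `[< U' w' >] then Th (f (Th' w')) else w'.

Lemma isotropy_conj_funE f w' : U' w' -> isotropy_conj_fun f w' = Th (f (Th' w')).
Proof. by move=> Uw; rewrite /isotropy_conj_fun asboolT. Qed.

Lemma isotropy_conj_fun_in f : isotropy f ->
  forall w', U' w' -> U' (isotropy_conj_fun f w').
Proof.
by move=> If w' Uw; rewrite isotropy_conj_funE //; exact: isotropy_conj_in.
Qed.

Lemma isotropy_conj_funK (f g : homeo U) : isotropy f ->
  (forall w, U w -> g (f w) = w) ->
  forall w', U' w' -> isotropy_conj_fun g (isotropy_conj_fun f w') = w'.
Proof.
move=> If fK w' Uw; have Uf := isotropy_conj_fun_in If Uw.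
rewrite (isotropy_conj_funE g Uf) isotropy_conj_funE // ThK; last first.
  by apply: UV; apply: hm_fun_in; exact: ThU.
by rewrite fK; [apply: ThK'; exact: UV'|exact: ThU].
Qed.

Lemma isotropy_conj_fun_cont f : {within U', continuous (isotropy_conj_fun f)}.
Proof.
apply: uniformly_continuous_within => e e0.
have [d d0 Hd] := isotropy_conj_uniform f e0; exists d => // u v Uu Uv uv.
by rewrite !isotropy_conj_funE //; exact: Hd.
Qed.

Lemma isotropy_conj_fun_out f w' : ~ U' w' -> isotropy_conj_fun f w' = w'.
Proof. by move=> nU; rewrite /isotropy_conj_fun asboolF. Qed.

Definition isotropy_conj (f : homeo U) (If : isotropy f) : homeo U' :=
  Homeo (isotropy_conj_fun_in If) (isotropy_conj_fun_in (isotropyV If))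
    (isotropy_conj_funK (g := (f^-1)%g) If (fun w Uw => hm_funK f Uw))
    (isotropy_conj_funK (g := f) (isotropyV If) (fun w Uw => hm_invK f Uw))
    (@isotropy_conj_fun_cont f) (@isotropy_conj_fun_cont (f^-1)%g)
    (@isotropy_conj_fun_out f) (@isotropy_conj_fun_out (f^-1)%g).

Lemma isotropy_conj_isotropy (f : homeo U) (If : isotropy f) :
  isotropy (isotropy_conj If).
Proof.
split; last first.
  rewrite /= isotropy_conj_funE; last exact: ab_mem.
  by rewrite Thx' (If : _ /\ f x = x).2.
move=> e e0; have [h' Hh' fh] := isotropy_conj_approx If e0.
by exists h' => // w' Uw; rewrite /= isotropy_conj_funE //; exact: fh.
Qed.

Definition transfer (f : isotropy_group B l) : isotropy_group B' m :=
  exist _ (isotropy_conj (set_mem (valP f)))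
    (mem_set (isotropy_conj_isotropy (set_mem (valP f)))).

Lemma transferE f w' : U' w' -> val (transfer f) w' = Th (val f (Th' w')).
Proof. exact: isotropy_conj_funE. Qed.

Lemma transferM : {morph transfer : f g / (f * g)%g}.
Proof.
move=> f g; apply/val_inj; apply: homeo_eq => w' Uw.
have Ug : U' (val (transfer g) w') by exact: hm_fun_in.
have -> : val (transfer f * transfer g)%g w' =
    val (transfer f) (val (transfer g) w') by [].
rewrite !transferE // ?ThK //; last by rewrite -transferE.
by apply: UV; apply: hm_fun_in; exact: ThU.
Qed.

HB.instance Definition _ := isMultiplicative.Build
  (isotropy_group B l) (isotropy_group B' m) transfer transferM.

Definition transfer_mul : {multiplicative isotropy_group B l -> isotropy_group B' m} :=
  transfer.

(** Lifting a fixed element of the smaller closure: the approximating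
    elements of the second group are conjugated back, extended to the whole
    adapted set, and Ascoli extracts a limit of the extensions. *)
Lemma transfer_surjective : hol_equicontinuous C ->
  forall f', exists f, transfer f = f'.
Proof.
move=> equi f'.
have [cf' fx'] : isotropy (val f') := set_mem (valP f').
have [_ ucTh ucTh' approx] := lc.
pose S (e : R) : set (homeo U) := [set h | ab_grp B l h /\
  forall w', U' w' -> mdist (h (Th' w')) (Th' (val f' w')) < e].
have S0 (e : R) : 0 < e -> S e !=set0.
  move=> e0; have e2 : 0 < e / 2 by rewrite divr_gt0.
  have [t' t'0 Ht'] := ab_thick B' m.
  have [d1 d10 Hd1] := ucTh' _ e2; have d12 : 0 < d1 / 2 by rewrite divr_gt0.
  have [d2 d20 Hd2] := homeo_uniform (val f') d12.
  have [h' Hh' fh] := cf' _ d12.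
  have [s [s0 st s2 se]] : exists s, [/\ 0 < s, s <= t', s <= d2 & s <= e / 2].
    exists (Num.min t' (Num.min d2 (e / 2))).
    by rewrite !lt_min t'0 d20 e2; split; rewrite // !ge_min ?lexx ?orTb ?orbT.
  have [phi [phi' [iphi phiTh phiTh' inter]]] := approx _ s0.
  have Uphi w : V w -> U' (phi w) <-> U' (Th w).
    by move=> Vw; apply: Ht'; exact: lt_le_trans (phiTh _ Vw) st.
  (* the preimage of [U'] under [phi] is its preimage under [Th], hence open *)
  pose A := [set w | U w /\ U' (Th w)].
  have AE w' : U' w' -> A (phi' w').
    move=> Uw; have [Vp pK] := iphi.2 _ (UV' Uw).
    have UT : U' (Th (phi' w')) by apply/Uphi => //; rewrite pK.
    by split => //; rewrite -(ThK Vp); exact: ThU.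
  have AU : A `<=` U by move=> w [].
  have Aphi w : A w -> U' (phi w) by move=> [Uw UTw]; apply/Uphi => //; exact: UV.
  have oA : open A.
    rewrite openE => w [Uw UTw]; apply: filterI.
      by apply: open_nbhs_nbhs; split => //; exact: ab_open.
    have [d d0 Hd] := ucTh _ t'0.
    have nU : nbhs w U by apply: open_nbhs_nbhs; split => //; exact: ab_open.
    have nd : nbhs w [set v | mdist w v < d] by apply: (near_mdist _ _).2; exists d.
    apply: filterS2 nU nd => v Uv wv /=.
    by apply: (Ht' _ _ (Hd _ _ (UV Uw) (UV Uv) wv)).1.
  pose k w := phi' (h' (phi w)).
  have kA w : A w -> A (k w).
    by move=> Aw; apply: AE; apply: hm_fun_in; exact: Aphi.
  have [h Hh kh] : exists2 h, ab_grp B l h & forall w, A w -> k w = h w.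
    apply: ab_grp_extend => //; first by move=> w /kA /AU.
    have [||_ H] := inter A k; [by move=> w /AU /UV|by move=> w /kA /AU /UV|].
    apply: H; have [r' Hr' rU] := ab_grp_hol Hh'.
    exists r' => // w Aw; rewrite /k (iphi.2 _ _).2; last first.
      by apply: UV'; apply: hm_fun_in; exact: Aphi.
    by apply: rU; exact: Aphi.
  exists h; split => // w' Uw.
  have ATh : A (Th' w').
    by split; [exact: ThU|rewrite ThK' //; exact: UV'].
  rewrite -kh //; have Up := Aphi _ ATh.
  have h1 : mdist (phi (Th' w')) w' < d2.
    rewrite -[w' in X in mdist _ X](ThK' (UV' Uw)).
    by apply: lt_le_trans s2; apply: phiTh; exact: UV (ThU Uw).
  have h2 := Hd2 _ _ Up Uw h1; have h3 := fh _ Up.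
  have h4 : mdist (h' (phi (Th' w'))) (val f' w') < d1.
    have := metric_triangle (h' (phi (Th' w'))) (val f' (phi (Th' w'))) (val f' w').
    by rewrite (metric_sym (h' _) (val f' (phi _))); lra.
  have Vh : V' (h' (phi (Th' w'))) by apply: UV'; exact: hm_fun_in.
  have h5 := Hd1 _ _ Vh (UV' (hm_fun_in (val f') Uw)) h4.
  have h6 := lt_le_trans (phiTh' _ Vh) se.
  have := metric_triangle (k (Th' w')) (Th' (h' (phi (Th' w')))) (Th' (val f' w')).
  by rewrite /k; lra.
have [_ _ sH _ _] := ab_adapted B l.
have [||f cf flim] := @uniform_closure_cluster _ _ _ (@ab_compact _ _ _ _ _ B l)
    (ab_grp B l) S sH (@ab_grp_equi _ _ _ _ _ B l equi) S0.
- by move=> e h [].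
- by move=> e e' ee' h [Hh hS]; split => // w' /hS; move=> /lt_le_trans; apply.
have fE w' : U' w' -> f (Th' w') = Th' (val f' w').
  move=> Uw; apply: mdist_small_eq => e e0; have e2 : 0 < e / 2 by rewrite divr_gt0.
  have [h [_ hS] fh] := flim _ e2.
  have := fh _ (ThU Uw); have := hS _ Uw.
  by have := metric_triangle (f (Th' w')) (h (Th' w')) (Th' (val f' w')); lra.
have If : isotropy f.
  by split => //; have := fE x' (ab_mem B' m); rewrite fx' Thx'.
exists (exist _ f (mem_set If)); apply/val_inj; apply: homeo_eq => w' Uw.
rewrite transferE //= fE // ThK' //; apply: UV'; exact: (hm_fun_in (val f')).
Qed.

End IsotropyTransfer.

(** * Limit conjugacies between arbitrary points *)

Section Existence.
Context {R : realType} {n n' : nat} {M M' : topologicalType}.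
Context {C : regular_covering R n M} {C' : regular_covering R n' M'}.
Context {f : M -> M'} {f' : M' -> M}.
Hypotheses (cf : continuous f) (cf' : continuous f') (fK : cancel f f') (fK' : cancel f' f).
Hypotheses (cM : compact [set: M]) (cM' : compact [set: M']) (conM' : connected [set: M']).
Hypotheses (equi : hol_equicontinuous C) (equi' : hol_equicontinuous C').
Context {kap : rc_X C -> 'I_(rc_nu C')} {kap' : rc_X C' -> 'I_(rc_nu C)}.
Hypotheses (kapP : coded_on f setT kap) (kapP' : coded_on f' setT kap').
Context {x : rc_X C} {x' : rc_X C'}.
Variable B' : adapted_basis x'.
Local Notation th := (theta f kap).
Local Notation th' := (theta f' kap').
Local Notation hol := (@hol_comp R n M C).
Local Notation hol' := (@hol_comp R n' M' C').

(** By minimality the adapted group moves [y] arbitrarily close to [x'], and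
    Ascoli gives a limit of the group elements that do so. *)
Lemma closure_transitive (y : rc_X C') : ab_set B' 0 y ->
  exists2 g, uniform_closure (ab_grp B' 0) g & g y = x'.
Proof.
move=> Uy.
pose S (e : R) : set (homeo (ab_set B' 0)) := [set h | ab_grp B' 0 h /\ mdist (h y) x' < e].
have S0 (e : R) : 0 < e -> S e !=set0.
  move=> e0.
  have [N HN] := ab_small B' ((near_mdist x' _).2 (ex_intro2 _ _ e e0 (fun w h => h))).
  have [ne cl _ _ _] := ab_adapted B' N.
  have [r Hr [z Uz yz]] := orbit_meets_clopen cM' equi' conM' cl ne y.
  have Uz0 : ab_set B' 0 z by exact: ab_sub Uz.
  have nz : nbhs z (ab_set B' 0) by apply: open_nbhs_nbhs; split => //; exact: ab_open.
  pose W := ab_set B' 0 `&` interior [set v | exists2 v', r v v' & ab_set B' 0 v'].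
  have oW : open W by apply: openI; [exact: ab_open|exact: open_interior].
  have Wy : W y by split => //; exact: hol_comp_near Hr _ _ _ yz nz.
  have /choice [g Hg] : forall v, exists v', W v -> r v v' /\ ab_set B' 0 v'.
    move=> v; have [Wv|nWv] := pselect (W v); last by exists v.
    by have [_ /interior_subset [v' rv Uv]] := Wv; exists v'.
  have [h Hh gh] : exists2 h, ab_grp B' 0 h & forall w, W w -> g w = h w.
    apply: ab_grp_extend => //; first by move=> w [].
      by move=> w /Hg [].
    by exists r => // w /Hg [].
  exists h; split => //; rewrite -gh // metric_sym.
  rewrite -(hol_comp_fun Hr yz (Hg y Wy).1).
  exact: (HN N (leqnn N) z Uz).
have [_ _ sH _ _] := ab_adapted B' 0.
have [||g cg glim] := @uniform_closure_cluster _ _ _ (@ab_compact _ _ _ _ _ B' 0)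
    (ab_grp B' 0) S sH (@ab_grp_equi _ _ _ _ _ B' 0 equi') S0.
- by move=> e h [].
- by move=> e e' ee' h [Hh hS]; split => //; exact: lt_le_trans ee'.
exists g => //; apply: mdist_small_eq => e e0; have e2 : 0 < e / 2 by rewrite divr_gt0.
have [h [_ hS] gh] := glim _ e2; have := gh y Uy.
by have := metric_triangle (g y) (h y) x'; lra.
Qed.

(** A limit conjugacy carrying [x] to [x']: the comparison map, followed by
    a holonomy map into an adapted set around [x'] and by an element of the
    closure of its adapted group. Its approximations replace the last factor
    by genuine group elements. *)
Lemma limit_conjugacy_exists : exists (V : set (rc_X C)) (V' : set (rc_X C')) Th Th',
  [/\ nbhs x V, nbhs x' V', Th x = x' & limit_conjugacy V V' Th Th'].
Proof.
have cX := @rc_compact _ _ _ C.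
have cth := theta_continuous cf kapP; have cth' := theta_continuous cf' kapP'.
have [ne0 cl0 _ _ _] := ab_adapted B' 0.
have [r0 Hr0 [y0 Uy0 r0y]] := orbit_meets_clopen cM' equi' conM' cl0 ne0 (th x).
have [s0 Hs0 s0E] := hol_comp_inv Hr0.
have [gh cgh ghy] := closure_transitive Uy0.
have nU0 (y : rc_X C') : ab_set B' 0 y -> nbhs y (ab_set B' 0).
  by move=> Uy; apply: open_nbhs_nbhs; split => //; exact: ab_open.
have [a1 a10 Ha1] := hol_transfer cf cM kapP equi.
have [a2 a20 Ha2] := hol_transfer cf' cM' kapP' equi'.
have [a3 a30 Ha3] := theta_injective_small cf kapP cf' fK kapP'.
have [a4 a40 Ha4] := theta_injective_small cf' kapP' cf fK' kapP.
have [rho Hrho nrho] := theta_roundtrip cf cf' fK kapP kapP' x.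
have [b2 b20 Hb2] := uniform_continuity cX cth a20.
have [b4 b40 Hb4] : exists2 d : R, 0 < d & forall w, mdist x w < d -> mdist (th x) (th w) < a4 / 2.
  by apply: ((continuous_mdist _ _).1 (cth x)); rewrite divr_gt0.
have nr0 : \forall w \near x, exists2 y, r0 (th w) y & ab_set B' 0 y.
  exact: cth (hol_comp_near Hr0 r0y (nU0 _ Uy0)).
have [b5 b50 Hb5] := (near_mdist _ _).1 (filterI nr0 nrho).
have [d [d0 dd1 dd2 dd3 dd45]] : exists d, [/\ 0 < d, d + d <= a1, d + d <= b2,
    d + d <= a3 / 2 & d <= b4 /\ d <= b5].
  exists (Num.min (a1 / 2) (Num.min (b2 / 2) (Num.min (a3 / 4) (Num.min b4 b5)))).
  have h1 (u v : R) : u <= v / 2 -> u + u <= v by move=> ?; lra.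
  rewrite !lt_min b40 b50 !divr_gt0 //; split => //.
  - by apply: h1; rewrite ge_min lexx.
  - by apply: h1; rewrite !ge_min lexx ?orbT.
  - by apply: h1; rewrite !ge_min (_ : a3 / 4 <= a3 / 2 / 2) ?orbT //; lra.
  - by rewrite !ge_min !lexx !orbT.
have [db4 db5] := dd45.
pose U := [set w | mdist x w < d].
have Ux : U x by rewrite /U /= mdistxx.
have nU : nbhs x U by apply: (near_mdist _ _).2; exists d.
have UU v w : U v -> U w -> mdist v w < d + d.
  rewrite /U /= => h1 h2; have := metric_triangle v x w.
  by rewrite (metric_sym v x); lra.
have Urho w : U w -> rho w (th' (th w)).
  by move=> Uw; have [] := Hb5 w (lt_le_trans Uw db5).
have /choice [G HG] : forall w, exists y, U w -> r0 (th w) y /\ ab_set B' 0 y.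
  move=> w; have [Uw|nUw] := pselect (U w); last by exists y0.
  by have [[y h1 h2] _] := Hb5 w (lt_le_trans Uw db5); exists y.
have Gx : G x = y0 by exact: hol_comp_fun Hr0 _ _ _ (HG x Ux).1 r0y.
have GU w : U w -> ab_set B' 0 (G w) by move=> /HG [].
have ucG : uniformly_continuous_on U G.
  move=> e e0; have [c c0 Hc] := equi' e0; have [c' c'0 Hc'] := uniform_continuity cX cth c0.
  exists c' => // u v Uu Uv uv.
  by apply: (Hc r0 Hr0 (th u) (th v)); [exact: (HG _ Uu).1|exact: (HG _ Uv).1|exact: Hc'].
have Gexp (e : R) : 0 < e -> exists2 c : R, 0 < c & forall u v, U u -> U v ->
    mdist (G u) (G v) < c -> mdist u v < e.
  move=> e0; have [eta eta0 Heta] := uniform_inverse cX cth a30 Ha3 e0.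
  have [c c0 Hc] := equi' eta0; exists c => // u v Uu Uv uv.
  apply: Heta; first exact: lt_le_trans (UU u v Uu Uv) dd3.
  by apply: (Hc s0 Hs0 (G u) (G v)) uv; apply/s0E; [exact: (HG _ Uu).1|exact: (HG _ Uv).1].
have Ginj u v : U u -> U v -> G u = G v -> u = v.
  move=> Uu Uv E; apply: mdist_small_eq => e e0; have [c c0 Hc] := Gexp e e0.
  by apply: Hc => //; rewrite E mdistxx.
(* near [th x], a point is recovered from its image under [th'], and the round
   trip [rho] is open *)
have nS : \forall y \near y0, exists2 w, U w & G w = y.
  have s0y : s0 y0 (th x) by apply/s0E.
  have [rhoi Hrhoi rhoiE] := hol_comp_inv Hrho.
  have rx : rhoi (th' (th x)) x by apply/rhoiE; exact: Urho.
  have nz : \forall z \near th' (th x), exists2 w, rhoi z w & U w.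
    exact: hol_comp_near Hrhoi _ _ _ rx nU.
  have nv : \forall v \near th x, (exists2 w, rhoi (th' v) w & U w) /\
      mdist (th x) v < a4 / 2.
    apply: filterI; first exact: (cth' (th x) _ nz).
    by apply: (near_mdist _ _).2; exists (a4 / 2) => //; rewrite divr_gt0.
  apply: filterS (hol_comp_near Hs0 s0y nv) => y [v /s0E r0v [[w rw Uw] xv]].
  exists w => //.
  have E : th' v = th' (th w) by apply: hol_comp_fun Hrho _ _ _ _ (Urho w Uw); apply/rhoiE.
  have vE : v = th w.
    apply: Ha4 E; have := metric_triangle v (th x) (th w).
    by have := Hb4 w (lt_le_trans Uw db4); rewrite (metric_sym v (th x)); lra.
  by apply: (hol_comp_fun Hr0 (HG w Uw).1); rewrite -vE.
have /choice [J HJ] : forall y, exists w, (exists2 w, U w & G w = y) -> U w /\ G w = y.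
  move=> y; have [[w h1 h2]|nw] := pselect (exists2 w, U w & G w = y); last by exists x.
  by exists w.
have ghix : hm_inv gh x' = y0 by have := hm_funK gh Uy0; rewrite ghy.
have [c0 c00 Hc0] := (near_mdist _ _).1 nS.
have ucghi : uniformly_continuous_on (ab_set B' 0) (hm_inv gh).
  exact: homeo_uniform (gh^-1)%g.
have [c1 c10 Hc1] := ucghi _ c00.
have [N HN] := ab_small B' ((near_mdist x' _).2 (ex_intro2 _ _ c1 c10 (fun w h => h))).
have {HN} HN := HN N (leqnn N).
pose V' := ab_set B' N.
have V'0 : V' `<=` ab_set B' 0 by exact: ab_sub.
have V'S w' : V' w' -> exists2 w, U w & G w = hm_inv gh w'.
  move=> Vw; apply: Hc0; rewrite -ghix; apply: Hc1; [exact: ab_mem|exact: V'0|exact: HN].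
have [t t0 Ht] := ab_thick B' N.
pose V := [set w | U w /\ V' (gh (G w))].
have ucgh : uniformly_continuous_on (ab_set B' 0) gh by exact: homeo_uniform.
pose Th w := gh (G w); pose Th' w' := J (hm_inv gh w').
have Thx : Th x = x' by rewrite /Th Gx.
(* a homeomorphism closer to [gh] than the gap [t] between [V'] and its
   complement has the same preimage of [V'] *)
have invg (g : homeo (ab_set B' 0)) :
    (forall w, ab_set B' 0 w -> mdist (gh w) (g w) < t) ->
    inverse_on V V' (fun w => g (G w)) (fun w' => J (hm_inv g w')) /\
    (forall w', V' w' -> exists2 w, U w & G w = hm_inv g w').
  move=> close.
  have VS w' : V' w' -> exists2 w, U w & G w = hm_inv g w'.
    move=> Vw; have Uz : ab_set B' 0 (hm_inv g w') by apply: hm_inv_in; exact: V'0.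
    have Vz : V' (gh (hm_inv g w')).
      by apply/(Ht _ _ (close _ Uz)); rewrite hm_invK //; exact: V'0.
    have [w Uw E] := V'S _ Vz; exists w => //.
    by rewrite E hm_funK.
  split => //; split.
    move=> w [Uw Vw]; split; first by apply/(Ht _ _ (close _ (GU _ Uw))).
    rewrite hm_funK; last exact: GU.
    have [h1 h2] := HJ (G w) (ex_intro2 _ _ w Uw erefl).
    exact: Ginj.
  move=> w' Vw; have [h1 h2] := HJ _ (VS _ Vw).
  have E : g (G (J (hm_inv g w'))) = w' by rewrite h2 hm_invK //; exact: V'0.
  split => //; split => //.
  by apply/(Ht _ _ (close _ (GU _ h1))); rewrite E.
have [|invTh _] := invg gh.
  by move=> w _; rewrite mdistxx.
exists V, V', Th, Th'; split => //.
- have nG : nbhs x [set w | V' (gh (G w))].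
    have [e1 e10 He1] := ucgh _ t0; have [e2 e20 He2] := ucG _ e10.
    have n1 : nbhs x [set w | mdist x w < e2] by apply: (near_mdist _ _).2; exists e2.
    apply: filterS2 n1 nU => w xw Uw /=.
    apply: (Ht (gh (G x)) _ _).1; last by rewrite -/(Th x) Thx; exact: ab_mem.
    by apply: He1; [exact: GU..|exact: He2].
  exact: filterI.
- by apply: open_nbhs_nbhs; split; [exact: ab_open|exact: ab_mem].
split => //.
- move=> e e0; have [e1 e10 He1] := ucgh _ e0; have [e2 e20 He2] := ucG _ e10.
  exists e2 => // u v [Uu _] [Uv _] uv.
  by apply: He1; [exact: GU..|exact: He2].
- move=> e e0; have [e1 e10 He1] := Gexp e e0; have [e2 e20 He2] := ucghi _ e10.
  exists e2 => // u v Vu Vv uv.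
  have [h1 h2] := HJ _ (V'S _ Vu); have [h3 h4] := HJ _ (V'S _ Vv).
  by apply: He1 => //; rewrite h2 h4; apply: He2 => //; exact: V'0.
move=> e e0; have [e1 e10 He1] := Gexp e e0; have [e2 e20 He2] := ucghi _ e10.
pose e3 := Num.min e (Num.min e2 t).
have e30 : 0 < e3 by rewrite !lt_min e0 e20.
have [e3e e3e2 e3t] : [/\ e3 <= e, e3 <= e2 & e3 <= t].
  by rewrite /e3; split; rewrite !ge_min ?lexx ?orTb ?orbT.
have [g Hg ghg] := cgh _ e30.
have [invG VSg] := invg g (fun w Uw => lt_le_trans (ghg w Uw) e3t).
exists (fun w => g (G w)), (fun w' => J (hm_inv g w')); split => //.
- by move=> w [Uw _]; rewrite metric_sym; apply: lt_le_trans e3e; apply: ghg; exact: GU.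
- move=> w' Vw; have [h1 h2] := HJ _ (VSg _ Vw); have [h3 h4] := HJ _ (V'S _ Vw).
  apply: He1 => //; rewrite h2 h4.
  have Uz : ab_set B' 0 (hm_inv g w') by apply: hm_inv_in; exact: V'0.
  rewrite -{1}(hm_funK gh Uz); apply: He2; [exact: hm_fun_in|exact: V'0|].
  rewrite -[X in mdist _ X](hm_invK g (V'0 _ Vw)).
  exact: lt_le_trans (ghg _ Uz) e3e2.
have [s Hs sU] := ab_grp_hol Hg.
have [si Hsi siE] := hol_comp_inv Hs.
have toth w : V w -> exists2 y, r0 (th w) y & s y (g (G w)).
  by move=> [Uw _]; exists (G w); [exact: (HG _ Uw).1|apply: sU; exact: GU].
move=> A k AV kV; split.
  move=> [r Hr rA]; have [[a Aa]|A0] := pselect (A !=set0); last first.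
    by exists r0 => // w Aw; exfalso; apply: A0; exists w.
  have [|w Aw|r' Hr' r'A] := Ha1 a A _ Aa r Hr.
  - by move=> w Aw; apply: lt_le_trans (UU _ _ (AV _ Aa).1 (AV _ Aw).1) dd1.
  - by exists (k w); exact: rA.
  exists (fun u v => exists z, (exists z1, (exists z2, si u z2 /\ s0 z2 z1) /\ r' z1 z)
    /\ (exists z3, r0 z z3 /\ s z3 v)).
    by do 3 (apply: hol_comp_comp => //).
  move=> w Aw; have [y1 h1 h2] := toth w (AV w Aw); have [y2 h3 h4] := toth _ (kV w Aw).
  exists (th (k w)); split; last by exists y2.
  exists (th w); split; last by apply: r'A => //; exact: rA.
  by exists y1; split; [apply/siE|apply/s0E].
move=> [r' Hr' rA]; have [[a Aa]|A0] := pselect (A !=set0); last first.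
  by exists rho => // w Aw; exfalso; apply: A0; exists w.
pose q u v := exists z, (exists z1, (exists z2, r0 u z2 /\ s z2 z1) /\ r' z1 z)
    /\ (exists z3, si z z3 /\ s0 z3 v).
have Hq : hol' q by do 3 (apply: hol_comp_comp => //).
have qA w : A w -> q (th w) (th (k w)).
  move=> Aw; have [y1 h1 h2] := toth w (AV w Aw); have [y2 h3 h4] := toth _ (kV w Aw).
  exists (g (G (k w))); split; last by exists y2; split; [apply/siE|apply/s0E].
  by exists (g (G w)); split; [exists y1|exact: rA].
have smA w' : (th @` A) w' -> mdist (th a) w' < a2.
  move=> [w Aw <-]; apply: Hb2.
  exact: lt_le_trans (UU _ _ (AV _ Aa).1 (AV _ Aw).1) dd2.
have Ata : (th @` A) (th a) by exists a.
have [|r Hr r1A] := Ha2 (th a) (th @` A) smA Ata q Hq.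
  by move=> w' [w Aw <-]; exists (th (k w)); exact: qA.
have [rhoi Hrhoi rhoiE] := hol_comp_inv Hrho.
exists (fun u v => exists z, (exists z1, rho u z1 /\ r z1 z) /\ rhoi z v).
  by do 2 (apply: hol_comp_comp => //).
move=> w Aw; exists (th' (th (k w))); split; last by apply/rhoiE/Urho; have [] := kV w Aw.
exists (th' (th w)); split; first by apply: Urho; have [] := AV w Aw.
by apply: r1A; [exists w|exact: qA].
Qed.

End Existence.

(** * Interleaving and tail equivalence *)

Section Interleaving.

(** The sequence G_0, K_0, G_1, K_1, ... Shifting the two sequences in the
    recursion, instead of testing the parity of the index, makes all terms
    and maps reduce to those of the given sequences. *)
Fixpoint interleave_grp (k : nat) (G K : nat -> groupType) : groupType :=
  if k is k'.+1 then interleave_grp k' K (fun i => G i.+1) else G 0.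

Fixpoint interleave_map (k : nat) (G K : nat -> groupType)
    (a : forall i, {multiplicative G i -> K i})
    (b : forall i, {multiplicative K i -> G i.+1}) :
    {multiplicative interleave_grp k G K -> interleave_grp k.+1 G K} :=
  match k with
  | 0 => a 0
  | k'.+1 => @interleave_map k' K (fun i => G i.+1) b (fun i => a i.+1)
  end.

Fixpoint interleave_even (i : nat) (G K : nat -> groupType) :
    {multiplicative G i -> interleave_grp i.*2 G K} :=
  match i with
  | 0 => (idfun : {multiplicative G 0 -> G 0})
  | i'.+1 => interleave_even i' (fun j => G j.+1) (fun j => K j.+1)
  end.

Definition interleave_odd (i : nat) (G K : nat -> groupType) :
    {multiplicative K i -> interleave_grp i.*2.+1 G K} :=
  interleave_even i K (fun j => G j.+1).

Lemma interleave_even_bij i (G K : nat -> groupType) : bijective (interleave_even i G K).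
Proof.
elim: i G K => [|i IH] G K; first by exists id.
exact: (IH (fun j => G j.+1) (fun j => K j.+1)).
Qed.

Lemma interleave_map_even i (G K : nat -> groupType) (a : forall i, {multiplicative G i -> K i})
    (b : forall i, {multiplicative K i -> G i.+1}) g :
  interleave_map i.*2 a b (interleave_even i G K g) = interleave_odd i G K (a i g).
Proof.
elim: i G K a b g => [//|i IH] G K a b g.
exact: (IH (fun j => G j.+1) (fun j => K j.+1) (fun j => a j.+1) (fun j => b j.+1)).
Qed.

Lemma interleave_map_odd i (G K : nat -> groupType) (a : forall i, {multiplicative G i -> K i})
    (b : forall i, {multiplicative K i -> G i.+1}) k :
  interleave_map i.*2.+1 a b (interleave_odd i G K k) = interleave_even i.+1 G K (b i k).
Proof. exact: (@interleave_map_even i K (fun j => G j.+1) b (fun j => a j.+1) k). Qed.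

Lemma interleave_map_surj k (G K : nat -> groupType) (a : forall i, {multiplicative G i -> K i})
    (b : forall i, {multiplicative K i -> G i.+1}) :
  (forall i y, exists z, a i z = y) -> (forall i y, exists z, b i z = y) ->
  forall y, exists z, interleave_map k a b z = y.
Proof.
elim: k G K a b => [|k IH] G K a b sa sb; first exact: sa.
exact: (IH K (fun j => G j.+1) b (fun j => a j.+1) sb (fun i => sa i.+1)).
Qed.

Lemma homo_ltn_id (p : nat -> nat) : {homo p : i j / (i < j)%N} ->
  forall i, (i <= p i)%N.
Proof.
by move=> hp; elim=> [//|i IH]; apply: leq_ltn_trans IH _; exact: hp.
Qed.

Lemma interleave_tail_equivalent (A B : group_seq) (p q : nat -> nat)
    (a : forall i, {multiplicative A (p i) -> B (q i)})
    (b : forall i, {multiplicative B (q i) -> A (p i.+1)}) :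
  gs_surjective A -> gs_surjective B ->
  {homo p : i j / (i < j)%N} -> {homo q : i j / (i < j)%N} ->
  (forall i y, exists z, a i z = y) -> (forall i y, exists z, b i z = y) ->
  (forall i (z : A (p i)) (z' : A (p i.+1)), gs_comp z z' -> b i (a i z) = z') ->
  (forall i (z : B (q i)) (z' : B (q i.+1)), gs_comp z z' -> a i.+1 (b i z) = z') ->
  tail_equivalent A B.
Proof.
move=> sA sB hp hq sa sb ba ab; split => //.
pose G i := A (p i); pose K i := B (q i).
exists p, q, (@GroupSeq (fun k => interleave_grp k G K)
  (fun k => @interleave_map k G K a b)), (fun i => interleave_even i G K),
  (fun i => interleave_odd i G K); split.
- by split => //; exact: homo_ltn_id.
- by split => //; exact: homo_ltn_id.
- split.
  + by move=> k; exact: interleave_map_surj.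
  + by move=> i; exact: interleave_even_bij.
  + by move=> i; exact: interleave_even_bij.
- move=> i z z' zz' /=.
  by rewrite interleave_map_even interleave_map_odd (ba _ _ _ zz').
- move=> i z z' zz' /=.
  rewrite interleave_map_odd.
  have := @interleave_map_even i.+1 G K a b (b i z).
  by rewrite (ab _ _ _ zz').
Qed.

End Interleaving.

Section Discriminant.
Context {R : realType} {n : nat} {M : topologicalType}.
Context {C : regular_covering R n M} {x : rc_X C}.
Variable B : adapted_basis x.

Lemma discriminant_surjective : hol_equicontinuous C ->
  gs_surjective (discriminant_seq B).
Proof.
move=> equi i b.
have ThU w : ab_set B i.+1 w -> ab_set B i (id w) by exact: ab_desc.
have [a Ha] := transfer_surjective (limit_conjugacy_id (ab_set B i))
  (erefl x : id x = x) (@subset_refl _ _) (ab_desc B i) ThU equi b.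
exists a; apply/val_inj; apply: homeo_eq => w Uw.
by rewrite [LHS]sigmaE // -Ha transferE.
Qed.

Lemma gs_comp_restriction m (a : discriminant_seq B m) k (b : discriminant_seq B k) :
  gs_comp a b -> forall w, ab_set B k w ->
  val (b : isotropy_group B k) w = val (a : isotropy_group B m) w.
Proof.
elim=> [//|j c _ IH w Uw].
by rewrite -IH; [exact: sigmaE|exact: ab_desc].
Qed.

End Discriminant.

Section TailEquivalence.
Context {R : realType} {n n' : nat} {M M' : topologicalType}.
Context {C : regular_covering R n M} {C' : regular_covering R n' M'}.
Context {x : rc_X C} {x' : rc_X C'}.
Variables (B : adapted_basis x) (B' : adapted_basis x').

(** Continuity of [Th'] at [x']: late adapted sets around [x'] fit into a given
    one around [x]. *)
Lemma limit_conjugacy_near V V' (Th : rc_X C -> rc_X C') Th' l : limit_conjugacy V V' Th Th' ->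
  Th x = x' -> nbhs x V -> nbhs x' V' ->
  exists N, forall m, (N <= m)%N -> ab_set B' m `<=` V' /\
    forall w', ab_set B' m w' -> ab_set B l (Th' w').
Proof.
move=> [iT _ ucTh' _] Thx nV nV'.
have [t t0 Ht] := ab_thick B l; have [d d0 Hd] := ucTh' _ t0.
have n1 : nbhs x' (V' `&` [set w' | mdist x' w' < d]).
  by apply: filterI => //; apply: (near_mdist _ _).2; exists d.
have [N HN] := ab_small B' n1; exists N => m Nm.
split=> w' Uw; have [Vw xw] := HN m Nm w' Uw; first by [].
have Thx' : Th' x' = x by rewrite -Thx (iT.1 _ (nbhs_singleton nV)).2.
apply: (Ht x _ _).1; last exact: ab_mem.
by rewrite -{1}Thx'; apply: Hd => //; exact: nbhs_singleton nV'.
Qed.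

End TailEquivalence.

Section TailEquivalenceMain.
Context {R : realType} {n n' : nat} {M M' : topologicalType}.
Context {C : regular_covering R n M} {C' : regular_covering R n' M'}.
Context {x : rc_X C} {x' : rc_X C'}.
Variables (B : adapted_basis x) (B' : adapted_basis x').

(** The transfer maps in the two directions are conjugations by inverse maps,
    so they compose to the restriction homomorphisms along two intertwined
    sequences of indices. *)
Lemma discriminant_tail_equivalent V V' Th Th' :
  hol_equicontinuous C -> hol_equicontinuous C' ->
  limit_conjugacy V V' Th Th' -> Th x = x' -> nbhs x V -> nbhs x' V' ->
  tail_equivalent (discriminant_seq B) (discriminant_seq B').
Proof.
move=> equi equi' lc Thx nV nV'.
have Thx' : Th' x' = x.
  by have [iT _ _ _] := lc; rewrite -Thx (iT.1 _ (nbhs_singleton nV)).2.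
have lc' := limit_conjugacy_sym lc.
(* [F l] and [F' m] are indices from which on the inclusions hold *)
have /choice [F HF] := fun l => limit_conjugacy_near B B' l lc Thx nV nV'.
have /choice [F' HF'] := fun m => limit_conjugacy_near B' B m lc' Thx' nV' nV.
have [N0 HN0] := ab_small B nV.
pose next (pq : nat * nat) := let p := maxn pq.1.+1 (F' pq.2) in (p, maxn pq.2.+1 (F p)).
pose pq i := iter i next (N0, F N0).
pose p i := (pq i).1; pose q i := (pq i).2.
have pS i : p i.+1 = maxn (p i).+1 (F' (q i)) by [].
have qS i : q i.+1 = maxn (q i).+1 (F (p i.+1)) by [].
have incr (s : nat -> nat) : (forall i, (s i < s i.+1)%N) -> {homo s : i j / (i < j)%N}.
  by move=> hs; apply: homo_ltn hs; exact: ltn_trans.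
have hp : {homo p : i j / (i < j)%N} by apply: incr => i; rewrite pS leq_max leqnn.
have hq : {homo q : i j / (i < j)%N} by apply: incr => i; rewrite qS leq_max leqnn.
have pV i : ab_set B (p i) `<=` V.
  by apply: HN0; case: i => [//|i]; rewrite (ltnW (hp 0 i.+1 _)).
have Fq i : (F (p i) <= q i)%N by case: i => [//|i]; rewrite qS leq_max leqnn orbT.
have F'p i : (F' (q i) <= p i.+1)%N by rewrite pS leq_max leqnn orbT.
have qV i : ab_set B' (q i) `<=` V' by have [] := HF _ _ (Fq i).
have ThqU i w' : ab_set B' (q i) w' -> ab_set B (p i) (Th' w').
  by have [_] := HF _ _ (Fq i); exact.
have ThpU i w : ab_set B (p i.+1) w -> ab_set B' (q i) (Th w).
  by have [_] := HF' _ _ (F'p i); exact.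
have [iT _ _ _] := lc.
apply: (@interleave_tail_equivalent (discriminant_seq B) (discriminant_seq B') p q
  (fun i => transfer_mul lc Thx (pV i) (qV i) (@ThqU i))
  (fun i => transfer_mul lc' Thx' (qV i) (pV i.+1) (@ThpU i))).
- exact: discriminant_surjective.
- exact: discriminant_surjective.
- exact: hp.
- exact: hq.
- by move=> i; exact: transfer_surjective.
- by move=> i; exact: transfer_surjective.
- move=> i z z' /gs_comp_restriction zz'; apply/val_inj; apply: homeo_eq => w Uw.
  rewrite zz' // [LHS]transferE // transferE; last exact: ThpU.
  have Uw' : ab_set B (p i) w by apply: ab_sub Uw; exact/ltnW/hp.
  rewrite (iT.1 _ (pV _ _ Uw)).2.
  by rewrite (iT.1 _ _).2 //; apply: pV; exact: hm_fun_in.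
- move=> i z z' /gs_comp_restriction zz'; apply/val_inj; apply: homeo_eq => w Uw.
  rewrite zz' // [LHS]transferE // transferE; last exact: ThqU.
  have Uw' : ab_set B' (q i) w by apply: ab_sub Uw; exact/ltnW/hq.
  rewrite (iT.2 _ (qV _ _ Uw)).2.
  by rewrite (iT.2 _ _).2 //; apply: qV; exact: hm_fun_in.
Qed.

End TailEquivalenceMain.

Lemma equicontinuous_any_covering (R : realType) (n : nat) (M : topologicalType) :
  equicontinuous_matchbox_manifold R n M ->
  forall C : regular_covering R n M, hol_equicontinuous C.
Proof.
move=> [[X [c [[cM _ _ _] _ _]]] [C0 /equicontinuous_coveringW equi0]] C.
have cid : continuous (@id M) by move=> y; exact: cvg_id.
have [kap kapP] := exists_code C C0 cid; have [kap' kapP'] := exists_code C0 C cid.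
exact: (hol_equicontinuous_transfer cid cM kapP cid (fun y => erefl) kapP' equi0).
Qed.

Lemma discriminant_homeomorphism_invariant (R : realType) (n n' : nat)
    (M M' : topologicalType) (C : regular_covering R n M)
    (C' : regular_covering R n' M') (x : rc_X C) (x' : rc_X C')
    (B : adapted_basis x) (B' : adapted_basis x') :
  equicontinuous_matchbox_manifold R n M ->
  equicontinuous_matchbox_manifold R n' M' -> homeomorphic M M' ->
  tail_equivalent (discriminant_seq B) (discriminant_seq B').
Proof.
move=> hM hM' [f [f' [cf cf' fK fK']]].
have equi := equicontinuous_any_covering hM C.
have equi' := equicontinuous_any_covering hM' C'.
have [[X [c [[cM _ _ _] _ _]]] _] := hM.
have [[X' [c' [[cM' conM' _ _] _ _]]] _] := hM'.
have [kap kapP] := exists_code C C' cf; have [kap' kapP'] := exists_code C' C cf'.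
have [V [V' [Th [Th' [nV nV' Thx lc]]]]] :=
  limit_conjugacy_exists cf cf' fK fK' cM cM' conM' equi equi' kapP kapP' (x := x) B'.
exact: discriminant_tail_equivalent lc Thx nV nV'.
Qed.

Theorem theorem1p9 (R : realType) (n : nat) (M : topologicalType)
    (hM : equicontinuous_matchbox_manifold R n M) :
  (forall (C C' : regular_covering R n M) (x : rc_X C) (x' : rc_X C')
      (B : adapted_basis x) (B' : adapted_basis x'),
     tail_equivalent (discriminant_seq B) (discriminant_seq B')) /\
  (forall (n' : nat) (M' : topologicalType),
     equicontinuous_matchbox_manifold R n' M' -> homeomorphic M M' ->
     forall (C : regular_covering R n M) (C' : regular_covering R n' M')
       (x : rc_X C) (x' : rc_X C')
       (B : adapted_basis x) (B' : adapted_basis x'),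
     tail_equivalent (discriminant_seq B) (discriminant_seq B')).
Proof.
split=> [C C' x x' B B'|n' M' hM' homM C C' x x' B B'].
  apply: discriminant_homeomorphism_invariant => //.
  by exists id, id; split => // y; exact: cvg_id.
exact: discriminant_homeomorphism_invariant.
Qed.
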